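(* Let $F$ be a field and let $V$ be a four-dimensional vector space over $F$. For any parallelism $\parallel$ of $\mathbb{P}(V)$ the following properties are equivalent: (a) The parallelism $\parallel$ is Clifford. (b) Any two distinct parallel classes are contained in at least one geometric hyperplane of the Grassmann space $\mathbb{G}_1(V)$. (c) Any two distinct parallel classes are contained in a unique linear complex of lines of $\mathbb{P}(V)$, and this linear complex is general.
   Context: Fields are commutative and of arbitrary characteristic. For a vector space $U$ over $F$, $\mathbb{P}(U)$ is the projective space of all subspaces of $U$; points, lines, planes are the subspaces of vector dimension $1,2,3$. $\mathcal{L}(V)$ is the set of lines of $\mathbb{P}(V)$. A pencil of lines is the set of all lines through a point $p$ lying in a plane $Z$, where $p\subset Z$. A parallelism of $\mathbb{P}(V)$ is an equivalence relation on $\mathcal{L}(V)$ such that each point is incident with precisely one line from each equivalence class; the equivalence classes are the parallel classes. Conditions on an $F$-algebra $H$ (with $F$ identified with $F\cdot 1_H$): (A) $H$ is a quaternion skew field with centre $F$ (so $[H:F]=4$); (B) $H$ is an extension field of $F$ with $[H:F]=4$ and $h^2\in F$ for all $h\in H$. For such $H$, lines $M,N$ of $\mathbb{P}(H)$ are left parallel if $cM=N$ for some $c\in H\setminus\{0\}$, and right parallel if $Mc=N$ for some $c\in H\setminus\{0\}$; these two parallelisms are the canonical Clifford parallelisms of $\mathbb{P}(H)$. A parallelism $\parallel$ of $\mathbb{P}(V)$ is Clifford if the $F$-vector space $V$ can be made into an $F$-algebra $H:=V$ satisfying (A) or (B) such that $\parallel$ coincides with one of the canonical Clifford parallelisms of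 $\mathbb{P}(H)$. The Grassmann space $\mathbb{G}_1(V)$ is the partial linear space whose ''points'' are the lines of $\mathbb{P}(V)$ and whose ''lines'' are the pencils of lines of $\mathbb{P}(V)$. A geometric hyperplane of $\mathbb{G}_1(V)$ is a proper subset $\mathcal{H}$ of $\mathcal{L}(V)$ such that each pencil of lines either contains a single element of $\mathcal{H}$ or is entirely contained in $\mathcal{H}$. The Plücker embedding $\gamma$ maps a line $M$ to the point $M^\gamma=F(u\wedge v)$ of $\mathbb{P}(V\wedge V)$, where $u,v$ is any basis of $M$; the Klein quadric $\mathcal{Q}$ is its image. A linear complex of lines of $\mathbb{P}(V)$ is a set of the form $\{X\in\mathcal{L}(V)\mid X^\gamma\subset W\}$ for some hyperplane $W$ of $V\wedge V$. It is special if $W$ is tangent to the Klein quadric, equivalently if the complex consists of all lines that meet or are equal to a fixed line $A$ (its axis), and general otherwise. (A set of lines is a general linear complex if and only if it is the set of null lines of a null polarity, i.e. the set of totally isotropic lines of a non-degenerate alternating bilinear form on $V$.) *)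

(* Defs.v *)
From HB Require Import structures.
From mathcomp Require Import all_boot all_algebra falgebra classical_sets ring.

Set Implicit Arguments.
Unset Strict Implicit.
Unset Printing Implicit Defensive.

Import GRing.Theory VectorInternalTheory.
Local Open Scope ring_scope.
Local Open Scope classical_set_scope.

Section ProjectiveSpace.

Variables (F : fieldType) (V : vectType F).

Record line := Line {
  line_space :> {vspace V};
  line_dim : \dim line_space == 2%N }.

HB.instance Definition _ := [isSub for line_space].
HB.instance Definition _ := [Equality of line by <:].

Definition is_pencil (P : set line) : Prop :=
  exists p Z : {vspace V},
    [/\ \dim p = 1%N, \dim Z = 3%N, (p <= Z)%VS &
        P = [set M : line | (p <= M)%VS && (M <= Z)%VS]].

Definition geometric_hyperplane (H : set line) : Prop :=
  H <> setT /\
  forall P, is_pencil P -> (exists! M, (P `&` H) M) \/ P `<=` H.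

Definition parallelism (par : line -> line -> Prop) : Prop :=
  RelationClasses.Equivalence par /\
  forall (p : {vspace V}) (M : line), \dim p = 1%N ->
    exists! N : line, par M N /\ (p <= N)%VS.

Definition parallel_class (par : line -> line -> Prop) (S : set line) : Prop :=
  exists M, S = [set N | par M N].

(* V /\ V is realized as the space of alternating tensors inside V (x) V, the
   latter being square matrices: u /\ v is u (x) v - v (x) u.  This is a model
   of the exterior square in every characteristic, 2 included. *)
Definition wedge (u v : V) : 'M[F]_(dim V) :=
  (v2r u)^T *m v2r v - (v2r v)^T *m v2r u.

Definition ext2 : {vspace 'M[F]_(dim V)} :=
  <<[seq wedge u v | u <- vbasis {:V}, v <- vbasis {:V}]>>%VS.

(* By plucker_basis below, any basis of M gives the same point. *)
Definition plucker (M : line) : {vspace 'M[F]_(dim V)} :=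
  <[wedge (vbasis M)`_0 (vbasis M)`_1]>%VS.

Definition klein_quadric : set {vspace 'M[F]_(dim V)} := range plucker.

Definition ext2_hyperplane (W : {vspace 'M[F]_(dim V)}) : Prop :=
  (W <= ext2)%VS /\ (\dim W).+1 = \dim ext2.

Definition complex_of (W : {vspace 'M[F]_(dim V)}) : set line :=
  [set X | (plucker X <= W)%VS].

Definition linear_complex (K : set line) : Prop :=
  exists2 W, ext2_hyperplane W & K = complex_of W.

(* The line T of P(V /\ V) is tangent at q: it meets the Klein quadric only in
   q, or it lies entirely on the Klein quadric. *)
Definition tangent_line_at (q T : {vspace 'M[F]_(dim V)}) : Prop :=
  [/\ \dim T = 2%N, (q <= T)%VS, klein_quadric q &
      (forall x, klein_quadric x -> (x <= T)%VS -> x = q) \/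
      (forall x, \dim x = 1%N -> (x <= T)%VS -> klein_quadric x)].

(* The tangent lines at q cover a hyperplane (the polar hyperplane of q), so a
   hyperplane all of whose lines through q are tangent at q is that one. *)
Definition tangent_hyperplane (W : {vspace 'M[F]_(dim V)}) : Prop :=
  ext2_hyperplane W /\
  exists q, [/\ klein_quadric q, (q <= W)%VS &
    forall T, \dim T = 2%N -> (q <= T)%VS -> (T <= W)%VS -> tangent_line_at q T].

Definition special_complex (K : set line) : Prop :=
  exists2 W, tangent_hyperplane W & K = complex_of W.

Definition general_complex (K : set line) : Prop :=
  linear_complex K /\ ~ special_complex K.

Lemma wedge_comb (a b c d : F) (u v : V) :
  wedge (a *: u + b *: v) (c *: u + d *: v) = (a * d - b * c) *: wedge u v.
Proof.
apply/matrixP=> i j; rewrite /wedge !linearD !linearZ /= !mxE !big_ord1 !mxE.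
ring.
Qed.

Lemma plucker_basis (M : line) (u v : V) :
  basis_of M [:: u; v] -> plucker M = <[wedge u v]>%VS.
Proof.
have [X eX bX] : exists2 X : seq V, X = vbasis M & basis_of M X.
  by exists (vbasis M) => //; exact: vbasisP.
have dM : \dim M = 2%N by apply/eqP; exact: line_dim.
have sX : size X = 2 by rewrite eX size_tuple.
rewrite /plucker -eX; case: X sX bX {eX} => [|x [|y []]] //= _.
have incl a b c d : basis_of M [:: a; b] -> basis_of M [:: c; d] ->
    (<[wedge a b]> <= <[wedge c d]>)%VS.
  move=> bab bcd.
  have comb w : w \in M -> exists s t : F, w = s *: c + t *: d.
    rewrite -(span_basis bcd) span_cons span_seq1.
    case/memv_addP=> _ /vlineP[s ->] [_ /vlineP[t ->] ->].
    by exists s, t.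
  have [s [t ->]] := comb a (basis_mem bab (mem_head _ _)).
  have [|s' [t' ->]] := comb b.
    by apply: (basis_mem bab); rewrite !inE eqxx orbT.
  by rewrite wedge_comb -memvE memvZ // memv_line.
by move=> bxy buv; apply/eqP; rewrite eqEsubv !incl.
Qed.

End ProjectiveSpace.

Section Clifford.

Variable F : fieldType.

Definition division_algebra (H : falgType F) : Prop :=
  forall h : H, h != 0 -> h \is a GRing.unit.

(* A quaternion skew field is a skew field of dimension 4 over its centre. *)
Definition condition_A (H : falgType F) : Prop :=
  [/\ division_algebra H, 'Z({:H})%VS = 1%VS & \dim {:H} = 4%N].

Definition condition_B (H : falgType F) : Prop :=
  [/\ division_algebra H, commutative (@GRing.mul H), \dim {:H} = 4%N &
      forall h : H, h ^+ 2 \in 1%VS].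

Definition left_parallel (H : falgType F) (M N : {vspace H}) : Prop :=
  exists2 c : H, c != 0 & (amull c @: M)%VS = N.

Definition right_parallel (H : falgType F) (M N : {vspace H}) : Prop :=
  exists2 c : H, c != 0 & (amulr c @: M)%VS = N.

(* An F-algebra structure on the F-vector space V is given by an F-algebra H
   together with an F-linear bijection phi : V -> H, along which the product
   of H is transported. *)
Definition clifford (V : vectType F) (par : line V -> line V -> Prop) : Prop :=
  exists (H : falgType F) (phi : 'Hom(V, H)),
    [/\ bijective phi, condition_A H \/ condition_B H &
        (forall M N : line V,
           par M N <-> left_parallel (phi @: M)%VS (phi @: N)%VS) \/
        (forall M N : line V,
           par M N <-> right_parallel (phi @: M)%VS (phi @: N)%VS)].

End Clifford.

(* Main.v *)
Require Import Defs.
From HB Require Import structures.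
From mathcomp Require Import all_boot all_algebra falgebra boolp classical_sets.
From mathcomp Require Import ring zify.

(** Everything is read off from alternating bilinear forms on V.  A hyperplane
    of the exterior square is the same thing as a nonzero alternating form B up
    to a scalar, and its linear complex is the set of lines on which B vanishes
    ([alternating_complex], [complex_alternating]).  The key remark about
    parallel classes is that no line meets all the members of a class
    ([disjoint_parallel]); it follows that a nonzero form vanishing on a class,
    and more generally a proper geometric hyperplane containing one, has no
    radical ([spread_radical_free]).

    A Clifford parallelism, say a left one, attaches to every line M the
    two-dimensional subalgebra x^-1 M of H, which depends neither on the
    point x of M nor on the choice of M in its parallel class, because every
    element of H is quadratic over F.  The lines whose subalgebra lies in a
    fixed hyperplane P of H form a geometric hyperplane; choosing P to contain
    the subalgebras of two given classes proves that these classes lie in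
    a common geometric hyperplane ([translates_hyperplane]).

    Conversely let a geometric hyperplane K contain two distinct classes.  The
    vectors x and y such that K contains the line joining them form a relation
    that is symmetric, linear in each argument and without radical, and such a
    relation is B x y = 0 for an alternating form B
    ([null_relation_alternating]).  Hence K is a linear complex.  It is the
    only one containing both classes, because the lines of K through a
    point x are those of the plane spanned by the two lines through x taken
    from the two classes ([polar_plane]); it is not special, because it
    contains a line disjoint from any prescribed axis
    ([special_complex_not_spread]).

    Finally suppose that any two classes are isotropic for a common form.
    Since a nonzero form that vanishes on a class is nondegenerate, it is
    determined by its values B x _ at one vector x. Comparing the forms that
    belong to various pairs of classes, one finds that they fill a
    three-dimensional space of forms whose nonzero elements are all
    nondegenerate, and that a line with basis y, z belongs to the class
    determined by the ratio B1 y z : B2 y z : B3 y z ([parallelism_net]).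
    Dividing B2 and B3 by B1 gives operators I and J; polarising the Pfaffian
    shows that I^2, J^2 and I J + J I lie in the span of 1, I, J, so that 1,
    I, J, I J span a division algebra H of dimension four, whose nonzero
    elements act simply transitively on the nonzero vectors
    ([pair_algebra_model]). As I and J are self-adjoint for B1, each of the
    three forms is invariant up to a scalar under the transformations
    commuting with H ([self_adjoint_invariant]). These are the left
    translations once V is identified with H, so left parallel lines are
    parallel, and then the two parallelisms agree. *)

Set Implicit Arguments.
Unset Strict Implicit.
Unset Printing Implicit Defensive.
Import GRing.Theory.
Local Open Scope classical_set_scope.

(** * Subspaces, lines and spreads *)

Section Spans.
Local Open Scope ring_scope.
Variables (F : fieldType) (V : vectType F).
Implicit Types (x y z u v w : V) (U W : {vspace V}).

Lemma mem_span2 x y w :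
  w \in <<[:: x; y]>>%VS <-> exists a b, w = a *: x + b *: y.
Proof.
rewrite span_cons span_seq1; split.
  by case/memv_addP=> _ /vlineP[a ->] [_ /vlineP[b ->] ->]; exists a, b.
by case=> a [b ->]; rewrite memv_add ?memvZ ?memv_line.
Qed.

Lemma mem_span3 x y z w :
  w \in <<[:: x; y; z]>>%VS <-> exists a b c, w = a *: x + b *: y + c *: z.
Proof.
rewrite span_cons; split.
  case/memv_addP=> _ /vlineP[a ->] [t /mem_span2[b [c ->]] ->].
  by exists a, b, c; rewrite addrA.
case=> a [b [c ->]]; rewrite -addrA memv_add ?memvZ ?memv_line //.
by apply/mem_span2; exists b, c.
Qed.

Lemma mem_span4 x y z t w : w \in <<[:: x; y; z; t]>>%VS <->
  exists a b c d, w = a *: x + b *: y + c *: z + d *: t.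
Proof.
rewrite span_cons; split.
  case/memv_addP=> _ /vlineP[a ->] [r /mem_span3[b [c [d ->]]] ->].
  by exists a, b, c, d; rewrite !addrA.
case=> a [b [c [d ->]]]; rewrite -!addrA memv_add ?memvZ ?memv_line //.
by apply/mem_span3; exists b, c, d; rewrite !addrA.
Qed.

Lemma free2P x y : free [:: x; y] <->
  (forall a b, a *: x + b *: y = 0 -> a = 0 /\ b = 0).
Proof.
split=> [/(@freeP _ _ 2 [tuple x; y]) fr a b e | fr].
  have := fr (fun i => [:: a; b]`_i); rewrite !big_ord_recl big_ord0 /= addr0.
  by move=> /(_ e) h; split; [exact: (h ord0) | exact: (h (lift ord0 ord0))].
apply/(@freeP _ _ 2 [tuple x; y]) => k.
rewrite !big_ord_recl big_ord0 /= addr0 => /fr[h1 h2] i.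
by case: i => [[|[|]]] //= hi; [rewrite -h1 | rewrite -h2];
  congr (k _); apply: val_inj.
Qed.

Lemma free4P x y z t : free [:: x; y; z; t] <->
  (forall a b c d, a *: x + b *: y + c *: z + d *: t = 0 ->
     [/\ a = 0, b = 0, c = 0 & d = 0]).
Proof.
split=> [/(@freeP _ _ 4 [tuple x; y; z; t]) fr a b c d e | fr].
  have := fr (fun i => [:: a; b; c; d]`_i).
  rewrite !big_ord_recl big_ord0 /= addr0 !addrA => /(_ e) h.
  split; [exact: (h ord0) | exact: (h (lift ord0 ord0)) | | ].
    exact: (h (lift ord0 (lift ord0 ord0))).
  exact: (h (lift ord0 (lift ord0 (lift ord0 ord0)))).
apply/(@freeP _ _ 4 [tuple x; y; z; t]) => k.
rewrite !big_ord_recl big_ord0 /= addr0 !addrA => /fr[h1 h2 h3 h4] i.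
by case: i => [[|[|[|[|]]]]] //= hi; [rewrite -h1 | rewrite -h2 | rewrite -h3 |
  rewrite -h4]; congr (k _); apply: val_inj.
Qed.

Lemma free_span4 x y z t : \dim {:V} = 4%N -> free [:: x; y; z; t] ->
  forall w, exists a b c d, w = a *: x + b *: y + c *: z + d *: t.
Proof.
move=> hV fr w; apply/mem_span4.
suff -> : <<[:: x; y; z; t]>>%VS = fullv by exact: memvf.
by apply/eqP; rewrite eqEdim subvf hV (eqP fr).
Qed.

Lemma exists_notin U : (\dim U < \dim {:V})%N -> exists w, w \notin U.
Proof.
move=> ltU; have : ~~ (fullv <= U)%VS.
  by apply/negP=> /dimvS; rewrite leqNgt ltU.
by case/subvPn=> w _ nUw; exists w.
Qed.

Lemma exists_capv U W X : (U <= X)%VS -> (W <= X)%VS ->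
  (\dim X < \dim U + \dim W)%N -> exists x, [/\ x != 0, x \in U & x \in W].
Proof.
move=> sU sW lt; exists (vpick (U :&: W)).
have := memv_pick (U :&: W); rewrite memv_cap => /andP[-> ->]; split=> //.
rewrite vpick0 -dimv_eq0 -lt0n.
have := dimv_sum_cap U W; have : (U + W <= X)%VS by rewrite subv_add sU.
by move/dimvS; lia.
Qed.

Lemma basis2_dimE U x y : \dim U = 2%N -> x \in U -> y \in U ->
  free [:: x; y] -> basis_of U [:: x; y].
Proof.
move=> d2 Ux Uy fr; rewrite basisEfree fr d2 /= andbT.
by apply/span_subvP=> w; rewrite !inE => /orP[] /eqP->.
Qed.

Lemma free2_notin x y : x != 0 -> y \notin <[x]>%VS -> free [:: x; y].
Proof.
move=> x0 ny; rewrite (perm_free (Y := [:: y; x])); last first.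
  by rewrite (perm_catC [:: x] [:: y]).
by rewrite free_cons span_seq1 ny seq1_free x0.
Qed.

Lemma plane_basis_from U x : \dim U = 2%N -> x != 0 -> x \in U ->
  exists y, basis_of U [:: x; y].
Proof.
move=> d2 x0 Ux; have : ~~ (U <= <[x]>)%VS.
  by apply/negP=> /dimvS; rewrite d2 dim_vline x0.
case/subvPn=> y Uy ny; exists y; apply: basis2_dimE => //.
exact: free2_notin.
Qed.

Lemma plane_basis U : \dim U = 2%N -> exists x y, basis_of U [:: x; y].
Proof.
move=> d2; have [] := @plane_basis_from U (vpick U) d2 _ (memv_pick _).
  by rewrite vpick0 -dimv_eq0 d2.
by move=> y b; exists (vpick U), y.
Qed.

Lemma basis2_mem U x y w : basis_of U [:: x; y] ->
  w \in U <-> exists a b, w = a *: x + b *: y.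
Proof. by move=> /span_basis <-; exact: mem_span2. Qed.

Lemma free2_lineP x y : free [:: x; y] ->
  exists M : line V, basis_of M [:: x; y].
Proof.
move=> fr; have d : \dim <<[:: x; y]>> == 2%N by rewrite (eqP fr).
by exists (Line d); rewrite basisEfree fr /= subvv (eqP d).
Qed.

End Spans.

Section SpreadsOfLines.
Local Open Scope ring_scope.
Variables (F : fieldType) (V : vectType F).
Variables (par : line V -> line V -> Prop) (hpar : parallelism par).
Implicit Types (x y z : V) (M N : line V).

Lemma par_refl M : par M M. Proof. by case: hpar => [[]]. Qed.
Lemma par_sym M N : par M N -> par N M. Proof. by case: hpar => [[? s ?] _] /s. Qed.
Lemma par_trans M N P : par M N -> par N P -> par M P.
Proof. by case: hpar => [[? s t] _] /t; apply. Qed.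

Lemma dim_line M : \dim M = 2%N. Proof. exact: eqP (line_dim M). Qed.

Lemma par_line M x : x != 0 -> exists2 N, par M N & x \in N.
Proof.
move=> x0; case: hpar => _ /(_ <[x]>%VS M); rewrite dim_vline x0.
by case=> // N [[pN +] _]; rewrite -memvE; exists N.
Qed.

Lemma par_meet M N x : par M N -> x != 0 -> x \in M -> x \in N -> M = N.
Proof.
move=> pMN x0 Mx Nx; case: hpar => _ /(_ <[x]>%VS M); rewrite dim_vline x0.
case=> // P [_ uP]; rewrite -(uP M) ?(uP N) //; rewrite -memvE; split=> //.
exact: par_refl.
Qed.

(** A class has a line missing A since it is too small inside a plane through A:
    two members of the class meeting A in points and lying in the plane
    A + z would meet each other.  So if all members met A, those through the
    points z + a, for a in A, would be one line containing the whole plane. *)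
Lemma disjoint_parallel (A : {vspace V}) M : \dim {:V} = 4%N -> \dim A = 2%N ->
  exists2 N, par M N & forall x, x \in A -> x \in N -> x = 0.
Proof.
move=> hV dA; apply: contrapT => hN.
have meet N : par M N -> exists x, [/\ x != 0, x \in A & x \in N].
  move=> pN; apply: contrapT => hx; apply: hN; exists N => // x Ax Nx.
  by apply: contrapT => /eqP x0; apply: hx; exists x.
have [z nAz] : exists z, z \notin A by apply: exists_notin; rewrite dA hV.
have dZ : \dim (A + <[z]>) = 3%N.
  have := dimv_sum_cap A <[z]>; rewrite dA dim_vline.
  have -> : z != 0 by apply: contraNneq nAz => ->; rewrite mem0v.
  have -> : (A :&: <[z]> = 0)%VS.
    apply/eqP; rewrite -subv0; apply/subvP=> w; rewrite memv_cap memv0.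
    case/andP=> Aw /vlineP[a ew]; rewrite ew scaler_eq0.
    have [//|a0] := eqVneq a 0; case/negP: nAz.
    by move: Aw; rewrite ew rpredZeq (negPf a0).
  by rewrite dimv0 addn0.
have inZ w a N : w \in (A + <[z]>)%VS -> w \notin A -> a != 0 -> a \in A ->
    w \in N -> a \in N -> (N <= A + <[z]>)%VS.
  move=> Zw nAw a0 Aa Nw Na.
  have b : basis_of N [:: a; w].
    apply: basis2_dimE => //; first exact: dim_line.
    apply: free2_notin => //; apply: contra nAw => /vlineP[k ->].
    by rewrite memvZ.
  rewrite -(span_basis b); apply/span_subvP=> t; rewrite !inE.
  by case/orP=> /eqP-> //; exact: subvP (addvSl _ _) _ Aa.
have Zz : z \in (A + <[z]>)%VS by exact: subvP (addvSr _ _) _ (memv_line z).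
have z0 : z != 0 by apply: contraNneq nAz => ->; rewrite mem0v.
have [N pN Nz] := par_line M z0.
have [a [a0 Aa Na]] := meet N pN.
have sN := inZ z a N Zz nAz a0 Aa Nz Na.
have sAN : (A <= N)%VS.
  apply/subvP=> b Ab.
  have nAw : z + b \notin A.
    by apply: contra nAz => Aw; rewrite -(addrK b z) memvB.
  have w0 : z + b != 0 by apply: contraNneq nAw => ->; rewrite mem0v.
  have Zw : z + b \in (A + <[z]>)%VS.
    by rewrite memvD // (subvP (addvSl _ _)).
  have [N' pN' Nw] := par_line M w0.
  have [a' [a'0 Aa' Na']] := meet N' pN'.
  have sN' := inZ _ a' N' Zw nAw a'0 Aa' Nw Na'.
  have [|x [x0 Nx N'x]] := exists_capv sN sN'; first by rewrite dZ !dim_line.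
  have e : N = N' by apply: par_meet x0 Nx N'x; exact: par_trans (par_sym pN) pN'.
  by move: Nw; rewrite -e -{2}(addKr z b) => Nw; rewrite memvD // memvN.
have : (A + <[z]> <= N)%VS by rewrite subv_add sAN -memvE.
by move/dimvS; rewrite dZ dim_line.
Qed.

End SpreadsOfLines.

(** * Alternating forms and null relations *)

Section NullRelations.
Local Open Scope ring_scope.
Variables (F : fieldType) (V : vectType F).
Implicit Types (x y z u v w : V).

Definition alternating (B : V -> V -> F) : Prop :=
  [/\ forall a x y z, B (a *: x + y) z = a * B x z + B y z,
      forall a x y z, B z (a *: x + y) = a * B z x + B z y &
      forall x, B x x = 0].

(** The properties of the relation B x y = 0 that survive in a geometric
    hyperplane of lines: [null_lin] and [null_exch] say that the vectors
    related to x form a subspace of codimension at most one. *)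
Record null_relation (R : V -> V -> Prop) : Prop := NullRelation {
  null_refl : forall x, R x x;
  null_sym : forall x y, R x y -> R y x;
  null_lin : forall a x y z, R x y -> R x z -> R x (a *: y + z);
  null_exch : forall x y z, exists a b,
    (a != 0) || (b != 0) /\ R x (a *: y + b *: z) }.

Definition radical_free (R : V -> V -> Prop) :=
  forall x, x != 0 -> exists y, ~ R x y.

Section AlternatingTheory.
Variables (B : V -> V -> F) (altB : alternating B).

Lemma altxx x : B x x = 0. Proof. by case: altB. Qed.
Lemma altPr a x y z : B z (a *: x + y) = a * B z x + B z y.
Proof. by case: altB. Qed.
Lemma altDl x y z : B (x + y) z = B x z + B y z.
Proof. by case: altB => h _ _; rewrite -[x]scale1r h mul1r scale1r. Qed.
Lemma alt0l z : B 0 z = 0.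
Proof. by apply: (@addrI _ (B 0 z)); rewrite -altDl !addr0. Qed.
Lemma altZl a x z : B (a *: x) z = a * B x z.
Proof. by case: altB => h _ _; rewrite -[a *: x]addr0 h alt0l addr0. Qed.
Lemma altDr x y z : B z (x + y) = B z x + B z y.
Proof. by rewrite -[x]scale1r altPr mul1r scale1r. Qed.
Lemma alt0r z : B z 0 = 0.
Proof. by apply: (@addrI _ (B z 0)); rewrite -altDr !addr0. Qed.
Lemma altZr a x z : B z (a *: x) = a * B z x.
Proof. by rewrite -[a *: x]addr0 altPr alt0r addr0. Qed.
Lemma altN x y : B y x = - B x y.
Proof.
apply/eqP; rewrite -addr_eq0; apply/eqP.
by have := altxx (x + y); rewrite altDl !altDr !altxx add0r addr0 addrC.
Qed.

Lemma alternating_null : null_relation (fun x y => B x y = 0).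
Proof.
split=> [x | x y e | a x y z e1 e2 | x y z]; first exact: altxx.
- by rewrite altN e oppr0.
- by rewrite altPr e1 e2 mulr0 addr0.
have [e | ne] := eqVneq (B x y) 0.
  by exists 1, 0; rewrite oner_eq0 altDr !altZr e mulr0 mul0r addr0.
exists (B x z), (- B x y); rewrite oppr_eq0 ne orbT; split=> //.
by rewrite altDr !altZr mulNr mulrC subrr.
Qed.

End AlternatingTheory.

Section NullTheory.
Variables (R : V -> V -> Prop) (nR : null_relation R).

Lemma null0 x : R x 0.
Proof. by have := null_lin nR (-1) (null_refl nR x) (null_refl nR x);
  rewrite scaleN1r addNr. Qed.
Lemma nullZ a x y : R x y -> R x (a *: y).
Proof. by move=> h; rewrite -[a *: y]addr0; apply: null_lin (null0 x). Qed.
Lemma nullD x y z : R x y -> R x z -> R x (y + z).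
Proof. by move=> hy hz; rewrite -[y]scale1r; apply: null_lin. Qed.
Lemma nullZK a x y : a != 0 -> R x (a *: y) -> R x y.
Proof. by move=> a0 /(nullZ a^-1); rewrite scalerK. Qed.
Lemma nullDK x y z : R x y -> R x (y + z) -> R x z.
Proof.
by move=> hy hz; rewrite -[z](addKr y) -scaleN1r; apply: null_lin.
Qed.
Lemma nullDKr x y z : R x y -> R x (z + y) -> R x z.
Proof. by rewrite addrC; exact: nullDK. Qed.

Lemma null_adjust u v w : ~ R u v -> exists a, R u (w - a *: v).
Proof.
move=> nuv; have [a [b [ab0 h]]] := null_exch nR u w v.
have a0 : a != 0.
  apply/eqP=> a0; move: ab0 h; rewrite a0 eqxx /= scale0r add0r => b0 h.
  exact: nuv (nullZK b0 h).
exists (- (a^-1 * b)); apply: (nullZK a0).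
by rewrite scaleNr opprK scalerDr scalerA mulrA divff // mul1r.
Qed.

(** Orthogonal projection along the hyperbolic pair u, v. *)
Lemma null_adjust2 u v w : ~ R u v ->
  exists a b, R u (w - a *: u - b *: v) /\ R v (w - a *: u - b *: v).
Proof.
move=> nuv; have [b hb] := null_adjust w nuv.
have nvu : ~ R v u by move/(null_sym nR).
have [a ha] := null_adjust w nvu.
exists a, b; split.
  rewrite addrAC; apply: nullD => //; rewrite -scaleNr; apply: nullZ.
  exact: null_refl.
apply: nullD => //; rewrite -scaleNr; apply: nullZ.
exact: null_refl.
Qed.

Lemma null_pair_free u v : ~ R u v -> free [:: u; v].
Proof.
move=> nuv; apply/free2P => a b e; have b0 : b = 0.
  apply/eqP/negP=> /negP b0; case: nuv; apply: (nullZK b0).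
  apply: (nullDK (y := a *: u)); first by apply: nullZ; exact: null_refl.
  by rewrite e; exact: null0.
split=> //; apply/eqP/negP=> /negP a0; apply: nuv; apply: (null_sym nR).
apply: (nullZK a0); move: e; rewrite b0 scale0r addr0 => ->; exact: null0.
Qed.

Hypothesis hV : \dim {:V} = 4%N.

Lemma null_plane_complement u v x w : ~ R u v -> R u x -> R v x -> R u w ->
  R v w -> free [:: x; w] -> free [:: u; v; x; w].
Proof.
move=> nuv ux vx uw vw /free2P fr; apply/free4P => a b c d e.
have b0 : b = 0.
  apply/eqP/negP=> /negP b0; case: nuv; apply: (nullZK b0).
  apply: (nullDK (y := a *: u)); first by apply: nullZ; exact: null_refl.
  apply: (nullDKr (nullZ c ux)); apply: (nullDKr (nullZ d uw)).
  by rewrite e; exact: null0.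
have a0 : a = 0.
  apply/eqP/negP=> /negP a0; apply: nuv; apply: (null_sym nR).
  apply: (nullZK a0); apply: (nullDKr (y := 0)); first exact: null0.
  apply: (nullDKr (nullZ c vx)); apply: (nullDKr (nullZ d vw)).
  by move: e; rewrite b0 scale0r => ->; exact: null0.
by move: e; rewrite a0 b0 !scale0r !add0r => /fr[-> ->].
Qed.

(** The radical of an alternating form has even codimension: here the part of
    the space orthogonal to the hyperbolic pair u, v is a plane containing x,
    and its other vectors are related to x, hence to everything. *)
Lemma radical_line x u v : ~ R u v -> x != 0 -> (forall y, R x y) ->
  exists w, free [:: x; w] /\ forall y, R w y.
Proof.
move=> nuv x0 dx; have sx y : R y x by apply: (null_sym nR).
have [w nw] : exists w, w \notin <<[:: u; v; x]>>%VS.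
  by apply: exists_notin; rewrite hV; exact: leq_ltn_trans (dim_span _) _.
have [a [b [hu hv]]] := null_adjust2 w nuv.
exists (w - a *: u - b *: v).
have fr : free [:: x; w - a *: u - b *: v].
  apply: free2_notin => //; apply: contra nw => /vlineP[k e].
  apply/mem_span3; exists a, b, k.
  by rewrite -e -[w - _ - _]addrA -opprD [RHS]addrC subrK.
split=> // y; have := null_plane_complement nuv (sx _) (sx _) hu hv fr.
move/(free_span4 hV)/(_ y) => [c [d [k [l ->]]]].
apply: nullD; last by apply: nullZ; exact: null_refl.
apply: nullD; last exact: nullZ.
by apply: nullD; apply: nullZ; apply: (null_sym nR).
Qed.

(** A nonzero radical contains a plane, which some line N of the class avoids;
    the relation is total on that plane, on N, and between them, hence on their
    sum, the whole space. *)
Lemma spread_radical_free par (hpar : parallelism par) M :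
  (forall N x y, par M N -> x \in N -> y \in N -> R x y) ->
  (exists x y, ~ R x y) -> radical_free R.
Proof.
move=> tot [u [v nuv]] x x0; apply: contrapT => /forallNP dx.
have {}dx y : R x y by apply: contrapT.
have [w [fr dw]] := radical_line nuv x0 dx.
have dL : \dim <<[:: x; w]>> = 2%N by rewrite (eqP fr).
have [N pN dj] := disjoint_parallel hpar M hV dL.
have [n1 [n2 bN]] := plane_basis (dim_line N).
have Nn1 : n1 \in N by apply: (basis_mem bN); rewrite inE eqxx.
have Nn2 : n2 \in N by apply: (basis_mem bN); rewrite !inE eqxx orbT.
have fr4 : free [:: x; w; n1; n2].
  apply/free4P => a b c d e.
  have /dj z0 : a *: x + b *: w \in <<[:: x; w]>>%VS.
    by apply/mem_span2; exists a, b.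
  have e2 : a *: x + b *: w = - (c *: n1 + d *: n2).
    by apply/eqP; rewrite -addr_eq0 addrA e.
  move: z0; rewrite {1}e2 memvN memvD ?memvZ // => /(_ isT) e0.
  have /free2P/(_ a b e0)[-> ->] := fr.
  move: e; rewrite e0 add0r.
  by have /free2P/(_ c d) := basis_free bN => h /h[-> ->].
apply: nuv; have [a [b [c [d ->]]]] := free_span4 hV fr4 u.
have [a' [b' [c' [d' ->]]]] := free_span4 hV fr4 v.
have Ny n y : n \in N -> R n y -> R y n by move=> _; exact: null_sym.
have Nall n : n \in N -> R n (a' *: x + b' *: w + c' *: n1 + d' *: n2).
  move=> Nn; apply: nullD; last by apply: nullZ; exact: (tot N).
  apply: nullD; last by apply: nullZ; exact: (tot N).
  by apply: nullD; apply: nullZ; apply: (null_sym nR).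
apply: (null_sym nR); apply: nullD; last first.
  by apply: nullZ; apply: (null_sym nR); exact: Nall.
apply: nullD; last by apply: nullZ; apply: (null_sym nR); exact: Nall.
by apply: nullD; apply: nullZ; apply: (null_sym nR).
Qed.

Hypothesis ndR : radical_free R.

(** The last condition fixes the scale of e4 relative to e1, e2, e3, so that the
    form represented by the relation is the standard symplectic one. *)
Lemma null_symplectic_basis : exists e1 e2 e3 e4 : V,
  [/\ free [:: e1; e2; e3; e4], [/\ R e1 e3, R e1 e4, R e2 e3 & R e2 e4],
      ~ R e1 e2 /\ ~ R e3 e4 & R (e1 + e3) (e2 - e4)].
Proof.
have [e1 n1] : exists e1 : V, e1 \notin (0%VS : {vspace V}).
  by apply: exists_notin; rewrite dimv0 hV.
have [|e2 n12] := ndR (x := e1); first by rewrite -memv0.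
have [w nw] : exists w, w \notin <<[:: e1; e2]>>%VS.
  by apply: exists_notin; rewrite hV; exact: leq_ltn_trans (dim_span _) _.
have [a [b]] := null_adjust2 w n12; set e3 := _ - _ - _ => -[h13 h23].
have e30 : e3 != 0.
  apply: contra nw => /eqP e; apply/mem_span2; exists a, b.
  by apply/eqP; rewrite -subr_eq0 opprD addrA -/e3 e.
have [z n3z] := ndR e30.
have [c [d]] := null_adjust2 z n12; set e4 := _ - _ - _ => -[h14 h24].
have n34 : ~ R e3 e4.
  move=> h; apply: n3z; have -> : z = e4 + (c *: e1 + d *: e2).
    by rewrite /e4 -[z - _ - _]addrA -opprD subrK.
  by apply: nullD => //; apply: nullD; apply: nullZ; apply: (null_sym nR).
have [p [q [pq h]]] := null_exch nR (e1 + e3) e2 e4.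
have p0 : p != 0.
  apply/eqP=> p0; move: pq h; rewrite p0 eqxx /= scale0r add0r => q0.
  move/(nullZK q0)/(null_sym nR)/(nullDK (null_sym nR h14))/(null_sym nR).
  exact: n34.
have q0 : q != 0.
  apply/eqP=> q0; move: pq h; rewrite q0 eqxx orbF scale0r addr0 => _.
  move/(nullZK p0)/(null_sym nR)/(nullDKr h23)/(null_sym nR).
  exact: n12.
pose s := - (p^-1 * q); have s0 : s != 0 by rewrite oppr_eq0 mulf_neq0 ?invr_eq0.
exists e1, e2, e3, (s *: e4); split.
- apply: null_plane_complement => //; first exact: nullZ; first exact: nullZ.
  by apply: null_pair_free => /(nullZK s0).
- by split=> //; apply: nullZ.
- by split=> // /(nullZK s0).
- apply: (nullZK p0); rewrite /s scaleNr opprK scalerDr scalerA mulrA divff //.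
  by rewrite mul1r.
Qed.

End NullTheory.
End NullRelations.

(** * Null relations without radical come from alternating forms *)

Section FourCoordinates.
Local Open Scope ring_scope.
Variables (F : fieldType) (V : vectType F) (e1 e2 e3 e4 : V).

Definition vec4 a b c d : V := a *: e1 + b *: e2 + c *: e3 + d *: e4.

Lemma vec4D a b c d a' b' c' d' :
  vec4 a b c d + vec4 a' b' c' d' = vec4 (a + a') (b + b') (c + c') (d + d').
Proof. by rewrite /vec4 !scalerDl addrACA; congr (_ + _); rewrite addrACA;
  congr (_ + _); rewrite addrACA. Qed.

Lemma vec4Z k a b c d :
  k *: vec4 a b c d = vec4 (k * a) (k * b) (k * c) (k * d).
Proof. by rewrite /vec4 !scalerDr !scalerA. Qed.

Hypotheses (hV : \dim {:V} = 4%N) (fr : free [:: e1; e2; e3; e4]).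

Lemma vec4_coord : exists p q r s : {scalar V},
  (forall x, x = vec4 (p x) (q x) (r x) (s x)) /\
  (forall a b c d, [/\ p (vec4 a b c d) = a, q (vec4 a b c d) = b,
     r (vec4 a b c d) = c & s (vec4 a b c d) = d]).
Proof.
pose X := [tuple e1; e2; e3; e4].
pose i k : 'I_4 := inord k.
have val a b c d k : coord X k (vec4 a b c d) = [:: a; b; c; d]`_k.
  have -> : vec4 a b c d = \sum_(j < 4) [:: a; b; c; d]`_j *: X`_j.
    by rewrite !big_ord_recl big_ord0 /= addr0 !addrA.
  exact: coord_sum_free.
exists (coord X (i 0%N)), (coord X (i 1%N)), (coord X (i 2%N)).
exists (coord X (i 3%N)); split=> [x | a b c d]; last first.
  by split; rewrite /= val /i inordK.
have [a [b [c [d ->]]]] := free_span4 hV fr x.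
by rewrite -/(vec4 a b c d) /= !val /i !inordK.
Qed.

End FourCoordinates.

Section Representation.
Local Open Scope ring_scope.
Variables (F : fieldType) (V : vectType F).
Implicit Types (x y z u v w : V).
Hypothesis hV : \dim {:V} = 4%N.

Lemma symplectic_form (e1 e2 e3 e4 : V) : free [:: e1; e2; e3; e4] ->
  exists2 B, alternating B & forall a b c d a' b' c' d',
    B (vec4 e1 e2 e3 e4 a b c d) (vec4 e1 e2 e3 e4 a' b' c' d') =
    a * b' - b * a' + (c * d' - d * c').
Proof.
move=> fr; have [p [q [r [s [dec coo]]]]] := vec4_coord hV fr.
exists (fun x y => p x * q y - q x * p y + (r x * s y - s x * r y)).
  by split=> [a x y z | a x y z | x]; rewrite ?linearP /=; ring.
move=> a b c d a' b' c' d'.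
have [-> -> -> ->] := coo a b c d.
by have [-> -> -> ->] := coo a' b' c' d'.
Qed.

(** In a symplectic basis of the relation, let B be the standard symplectic
    form.  Call x good if B x y = 0 implies R x y; by symmetry of R, a good x
    passes this on to every y with B x y = 0 whose component in <e1, e2> is
    independent of that of x.  Starting from e1 + e3, a few such steps reach
    every vector, whatever the field, so the semilinear ambiguity
    of the fundamental theorem of projective geometry does not arise. *)
Theorem null_relation_alternating (R : V -> V -> Prop) :
  null_relation R -> radical_free R ->
  exists2 B, alternating B & forall x y, R x y <-> B x y = 0.
Proof.
move=> nR ndR.
have [e1 [e2 [e3 [e4 [fr [h13 h14 h23 h24] [n12 n34] hS]]]]] :=
  null_symplectic_basis nR hV ndR.
have [B altB BE] := symplectic_form fr; exists B => //.
pose vec := vec4 e1 e2 e3 e4.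
have BEv a b c d a' b' c' d' : B (vec a b c d) (vec a' b' c' d') =
  a * b' - b * a' + (c * d' - d * c') by exact: BE.
have decE x : exists a b c d, x = vec a b c d by exact: free_span4.
have sR := null_sym nR.
have Rr x : R x x by exact: null_refl.
have RD x y z : R x y -> R x z -> R x (y + z) by exact: nullD.
have RZ a x y : R x y -> R x (a *: y) by exact: nullZ.
have vec12 a b : vec a b 0 0 = a *: e1 + b *: e2.
  by rewrite /vec /vec4 !scale0r !addr0.
have vec34 c d : vec 0 0 c d = c *: e3 + d *: e4.
  by rewrite /vec /vec4 !scale0r !add0r.
have Ruw a b c d : R (vec a b 0 0) (vec 0 0 c d).
  rewrite vec12 vec34; apply: (RD); apply: (RZ); apply: (sR);
  by apply: (RD); apply: (RZ); apply: (sR).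
have split4 a b c d : vec a b c d = vec a b 0 0 + vec 0 0 c d.
  by rewrite vec4D !add0r !addr0.
pose good x := forall y, B x y = 0 -> R x y.
have step a b c d a' b' c' d' : good (vec a b c d) ->
    a * b' - b * a' + (c * d' - d * c') = 0 -> a * b' - b * a' != 0 ->
    good (vec a' b' c' d').
  move=> gx e ne z; have [z1 [z2 [z3 [z4 ->]]]] := decE z.
  rewrite BEv => ez.
  have Ryx : R (vec a' b' c' d') (vec a b c d).
    by apply: (sR); apply: gx; rewrite BEv.
  have Ryu : R (vec a' b' c' d') (vec a' b' 0 0).
    by apply: (sR); rewrite [X in R _ X]split4; apply: (RD).
  have Ryw : R (vec a' b' c' d') (vec 0 0 c' d').
    by apply: (sR); rewrite [X in R _ X]split4; apply: (RD) => //; apply: (sR).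
  have ne2 : a' * b - b' * a != 0.
    have -> : a' * b - b' * a = - (a * b' - b * a') by ring.
    by rewrite oppr_eq0.
  have cd : c' * d - d' * c = - (a' * b - b' * a).
    by apply/eqP; rewrite -addr_eq0 -oppr_eq0 -[X in _ == X]e; apply/eqP; ring.
  have ne3 : c' * d - d' * c != 0 by rewrite cd oppr_eq0.
  have ez3 : c' * z4 - d' * z3 = - (a' * z2 - b' * z1).
    by apply/eqP; rewrite -addr_eq0 -[X in _ == X]ez; apply/eqP; ring.
  pose gam := (a' * z2 - b' * z1) / (a' * b - b' * a).
  have gamE : gam = (c' * z4 - d' * z3) / (c' * d - d' * c).
    by rewrite ez3 cd invrN mulrNN.
  have -> : vec z1 z2 z3 z4 =
      (z1 * b - z2 * a) / (a' * b - b' * a) *: vec a' b' 0 0 +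
      ((z3 * d - z4 * c) / (c' * d - d' * c) *: vec 0 0 c' d' +
       gam *: vec a b c d).
    rewrite /vec !vec4Z !vec4D; congr vec4; rewrite ?mulr0 ?add0r /gam.
    - by field.
    - by field.
    - by rewrite -/gam gamE; field.
    - by rewrite -/gam gamE; field.
  by apply: (RD); [|apply: (RD)]; apply: (RZ).
have good12 a b : a != 0 \/ b != 0 -> good (vec a b 0 0).
  move=> ab z; have [z1 [z2 [z3 [z4 ->]]]] := decE z.
  rewrite BEv !mul0r subrr addr0 => /eqP; rewrite subr_eq0 => /eqP ez.
  have [k [ea eb]] : exists k, z1 = k * a /\ z2 = k * b.
    case: ab => [a0|b0]; [exists (z1 / a) | exists (z2 / b)].
      by rewrite mulfVK //; split=> //; rewrite mulrAC [z1 * b]mulrC -ez mulrC mulKf.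
    by rewrite mulfVK //; split=> //; rewrite mulrAC [z2 * a]mulrC ez mulrC mulKf.
  have -> : vec z1 z2 z3 z4 = k *: vec a b 0 0 + vec 0 0 z3 z4.
    by rewrite /vec vec4Z vec4D ea eb !mulr0 !add0r !addr0.
  by apply: (RD) => //; apply: (RZ).
have good34 c d : c != 0 \/ d != 0 -> good (vec 0 0 c d).
  move=> cd z; have [z1 [z2 [z3 [z4 ->]]]] := decE z.
  rewrite BEv !mul0r subrr add0r => /eqP; rewrite subr_eq0 => /eqP ez.
  have [k [ea eb]] : exists k, z3 = k * c /\ z4 = k * d.
    case: cd => [a0|b0]; [exists (z3 / c) | exists (z4 / d)].
      by rewrite mulfVK //; split=> //; rewrite mulrAC [z3 * d]mulrC -ez mulrC mulKf.
    by rewrite mulfVK //; split=> //; rewrite mulrAC [z4 * c]mulrC ez mulrC mulKf.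
  have -> : vec z1 z2 z3 z4 = vec z1 z2 0 0 + k *: vec 0 0 c d.
    by rewrite /vec vec4Z vec4D ea eb !mulr0 !add0r !addr0.
  by apply: (RD) => //; [apply: (sR) | apply: (RZ)].
(* The normalisation of e4 is exactly what makes e1 + e3 good. *)
have good0 : good (vec 1 0 1 0).
  move=> z; have [z1 [z2 [z3 [z4 ->]]]] := decE z.
  rewrite BEv !mul1r !mul0r !subr0 => /eqP; rewrite addrC addr_eq0 => /eqP ez.
  have -> : vec z1 z2 z3 z4 = vec z1 0 z3 0 + z2 *: (e2 - e4).
    rewrite split4 !vec12 !vec34 ez /vec /vec4 !scale0r !addr0 scalerBr scaleNr.
    by rewrite addrACA.
  have -> : vec 1 0 1 0 = e1 + e3 by rewrite /vec /vec4 !scale0r !addr0 !scale1r.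
  apply: (RD); last exact: RZ.
  have -> : vec z1 0 z3 0 = z1 *: e1 + z3 *: e3.
    by rewrite /vec /vec4 !scale0r !addr0.
  by apply: (RD); apply: (RZ); apply: (sR); apply: (RD) => //; apply: (sR).
have good1 p q : good (vec p 1 q (-1)).
  by apply: step good0 _ _; rewrite !mul1r !mul0r !subr0 ?subrr ?oner_eq0.
have good2 a b c d : b != 0 -> d != 0 -> good (vec a b c d).
  move=> b0 d0; apply: (step _ _ _ _ _ _ _ _ (good1 ((1 + a) / b) (- (1 + c) / d))).
    by field; rewrite ?b0 ?d0.
  by rewrite mulfVK // mul1r addrK oner_eq0.
have goodV a b c d : good (vec a b c d).
  have [/eqP b0 | b0] := boolP (b == 0 :> F);
  have [/eqP d0 | d0] := boolP (d == 0 :> F).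
  - have [/eqP a0 | a0] := boolP (a == 0 :> F).
      have [/eqP c0 | c0] := boolP (c == 0 :> F).
        move=> y _; apply: (sR); rewrite a0 b0 c0 d0 /vec /vec4 !scale0r !addr0.
        exact: null0.
      by rewrite a0 b0; apply: good34; left.
    have [/eqP c0 | c0] := boolP (c == 0 :> F).
      by rewrite c0 d0; apply: good12; left.
    (* One more step is needed here, through c e2 - a e4. *)
    rewrite b0 d0; apply: (step 0 c 0 (- a)); first by apply: good2; rewrite ?oppr_eq0.
      by ring.
    by rewrite mulr0 sub0r oppr_eq0 mulf_neq0.
  - have [/eqP a0 | a0] := boolP (a == 0 :> F).
      by rewrite a0 b0; apply: good34; right.
    rewrite b0; apply: (step _ _ _ _ _ _ _ _ (good1 0 ((a - c) / d))).
      by field.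
    by rewrite mul0r mul1r sub0r oppr_eq0.
  - have [/eqP c0 | c0] := boolP (c == 0 :> F).
      by rewrite c0 d0; apply: good12; right.
    rewrite d0; apply: (step _ _ _ _ _ _ _ _ (good1 ((a - c) / b) 0)).
      by field.
    by rewrite mulfVK // mul1r addrAC subrr sub0r oppr_eq0.
  - exact: good2.
move=> x y; split=> [Rxy|]; last first.
  by have [a [b [c [d ->]]]] := decE x; exact: goodV.
apply/eqP/negP=> /negP Bxy.
have x0 : x != 0 by apply: contraNneq Bxy => ->; rewrite (alt0l altB).
have [z nz] := ndR _ x0; apply: nz.
have gx : good x by have [a [b [c [d ->]]]] := decE x; exact: goodV.
rewrite -(subrK (B x z / B x y *: y) z) addrC; apply: (RD); first exact: (RZ).
apply: gx; rewrite (altDr altB) -scaleNr (altZr altB) mulNr divfK ?subrr //.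
Qed.

End Representation.

(** * Hyperplanes of the exterior square are alternating forms *)

Section LinearComplexes.
Local Open Scope ring_scope.
Import VectorInternalTheory.
Variables (F : fieldType) (V : vectType F).
Implicit Types (x y z u v w : V) (W : {vspace 'M[F]_(dim V)}) (M N : line V).

Lemma wedge_alternating_l a x y z :
  wedge (a *: x + y) z = a *: wedge x z + wedge y z.
Proof.
by apply/matrixP=> i j; rewrite /wedge !linearP /= !mxE !big_ord1 !mxE; ring.
Qed.

Lemma wedgeC x y : wedge y x = - wedge x y.
Proof. by rewrite /wedge opprB. Qed.

Lemma wedge_alternating_r a x y z :
  wedge z (a *: x + y) = a *: wedge z x + wedge z y.
Proof.
by rewrite wedgeC wedge_alternating_l opprD -scalerN -!(wedgeC _ z).
Qed.

Lemma wedgexx x : wedge x x = 0. Proof. exact: subrr. Qed.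

Lemma wedge0l z : wedge 0 z = 0.
Proof. by rewrite /wedge linear0 trmx0 mul0mx mulmx0 subrr. Qed.

Lemma wedge_suml I (s : seq I) (f : I -> V) z :
  wedge (\sum_(i <- s) f i) z = \sum_(i <- s) wedge (f i) z.
Proof.
elim: s => [|i s IH]; first by rewrite !big_nil wedge0l.
by rewrite !big_cons -[f i]scale1r wedge_alternating_l !scale1r IH.
Qed.

Lemma wedgeZl a x z : wedge (a *: x) z = a *: wedge x z.
Proof. by rewrite -[a *: x]addr0 wedge_alternating_l wedge0l addr0. Qed.

Lemma wedge_ext2 x y : wedge x y \in ext2 V.
Proof.
have wx u : wedge x u = - wedge u x by rewrite wedgeC.
rewrite (coord_vbasis (memvf x)) wedge_suml; apply: memv_suml => i _.
rewrite wedgeZl memvZ // -[wedge _ _]opprK -wedgeC memvN.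
rewrite (coord_vbasis (memvf y)) wedge_suml; apply: memv_suml => j _.
rewrite wedgeZl memvZ // wedgeC memvN; apply: memv_span.
by apply/allpairsP; exists ((vbasis {:V})`_i, (vbasis {:V})`_j);
  rewrite !mem_nth ?size_tuple.
Qed.

Lemma mem_complex W M u v : basis_of M [:: u; v] ->
  complex_of W M <-> wedge u v \in W.
Proof. by move=> b; rewrite /complex_of /= (plucker_basis b) memvE. Qed.

(** Summing over i < j only, instead of over all pairs, keeps this valid in
    characteristic two: the full sum would give twice B. *)
Lemma alternating_functional B : alternating B ->
  exists L : 'Hom('M[F]_(dim V), F^o), forall u v, L (wedge u v) = B u v.
Proof.
move=> altB; pose e i : V := r2v (delta_mx 0 i).
pose f (A : 'M[F]_(dim V)) : F^o :=
  \sum_(i < dim V) \sum_(j < dim V | (i < j)%N) A i j * B (e i) (e j).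
have lf : linear f.
  move=> a A A'; rewrite /f scaler_sumr -big_split; apply: eq_bigr => i _.
  rewrite scaler_sumr -big_split; apply: eq_bigr => j _.
  by rewrite !mxE mulrDl [in RHS]/GRing.scale /= mulrA.
pose fl := GRing.isLinear.Build _ _ _ _ f lf.
pose fL : {linear _ -> _} := HB.pack f fl.
exists (linfun fL) => u v; rewrite lfunE /=.
have suml I (s : seq I) (g : I -> V) z :
    B (\sum_(i <- s) g i) z = \sum_(i <- s) B (g i) z.
  elim: s => [|i s IH]; first by rewrite !big_nil (alt0l altB).
  by rewrite !big_cons (altDl altB) IH.
have sumr I (s : seq I) (g : I -> V) z :
    B z (\sum_(i <- s) g i) = \sum_(i <- s) B z (g i).
  elim: s => [|i s IH]; first by rewrite !big_nil (alt0r altB).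
  by rewrite !big_cons (altDr altB) IH.
have dec w : w = \sum_i v2r w 0 i *: e i.
  apply: v2r_inj; rewrite linear_sum /= [LHS]row_sum_delta.
  by apply: eq_bigr => i _; rewrite linearZ /= r2vK.
have -> : B u v = \sum_i \sum_j v2r u 0 i * v2r v 0 j * B (e i) (e j).
  rewrite {1}[u]dec suml; apply: eq_bigr => i _.
  rewrite (altZl altB) {1}[v]dec sumr mulr_sumr; apply: eq_bigr => j _.
  by rewrite (altZr altB) mulrA.
transitivity (\sum_(i < dim V) (\sum_(j < dim V | (i < j)%N)
      v2r u 0 i * v2r v 0 j * B (e i) (e j)) -
   \sum_(i < dim V) (\sum_(j < dim V | (i < j)%N)
      v2r v 0 i * v2r u 0 j * B (e i) (e j))).
  rewrite -sumrB; apply: eq_bigr => i _; rewrite -sumrB; apply: eq_bigr => j _.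
  by rewrite /wedge !mxE !big_ord1 !mxE mulrBl.
pose g i j := v2r u 0 i * v2r v 0 j * B (e i) (e j).
have -> : \sum_(i < dim V) \sum_(j < dim V | (i < j)%N)
      v2r v 0 i * v2r u 0 j * B (e i) (e j) =
    - \sum_(i < dim V) \sum_(j < dim V | (j < i)%N) g i j.
  rewrite (exchange_big_dep xpredT) //= -sumrN; apply: eq_bigr => i _.
  rewrite -sumrN; apply: eq_bigr => j _.
  by rewrite /g (altN altB (e j)) mulrN opprK [v2r v 0 j * _]mulrC.
rewrite opprK -big_split; apply: eq_bigr => i _ /=.
rewrite [RHS](bigID (fun j : 'I_(dim V) => (i < j)%N)) /=; congr (_ + _).
rewrite [RHS](bigID (fun j : 'I_(dim V) => (j < i)%N)) /=.
rewrite [X in _ = _ + X]big1 ?addr0 => [|j].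
  by apply: eq_bigl => j; case: ltngtP.
rewrite -!leqNgt => /andP[h1 h2].
have -> : j = i by apply/val_inj/anti_leq; rewrite h1.
by rewrite (altxx altB) mulr0.
Qed.

Lemma alternating_complex B : alternating B -> (exists x y, B x y != 0) ->
  exists2 W, ext2_hyperplane W & forall u v, wedge u v \in W <-> B u v = 0.
Proof.
move=> altB [x [y nB]]; have [L LE] := alternating_functional altB.
exists (ext2 V :&: lker L)%VS; last first.
  move=> u v; rewrite memv_cap wedge_ext2 memv_ker LE.
  by rewrite andTb; split=> [/eqP | ->].
split; first exact: capvSl.
rewrite -(limg_ker_dim L (ext2 V)) -addn1; congr (_ + _)%N.
apply/eqP; rewrite eqn_leq; apply/andP; split; last first.
  by apply: leq_trans (dimvS (subvf _)) _; rewrite regular_fullv dimv1.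
rewrite lt0n dimv_eq0; apply: contra nB => /eqP e0.
have : L (wedge x y) \in (0%VS : {vspace F^o}).
  by rewrite -e0 memv_img // wedge_ext2.
by rewrite memv0 LE.
Qed.

(** The form is the coordinate of u /\ v along a complement of W in the
    exterior square. *)
Lemma complex_alternating W : ext2_hyperplane W ->
  exists B, [/\ alternating B, exists x y, B x y != 0 &
    forall u v, wedge u v \in W <-> B u v = 0].
Proof.
case=> sW dW; set E := ext2 V in sW dW.
have dD : \dim (E :\: W) = 1%N.
  have := dimv_cap_compl E W; rewrite (capv_idPr sW) -dW; lia.
set D := (E :\: W)%VS in dD; pose d := vpick D.
have d0 : d != 0 by rewrite vpick0 -dimv_eq0 dD.
have Dline : D = <[d]>%VS.
  by apply/esym/eqP; rewrite eqEdim -memvE memv_pick dim_vline d0 dD.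
have capDW : (D :&: W = 0)%VS by exact: capv_diff.
have sumDW : (D + W)%VS = E by rewrite addv_diff; apply/addv_idPl.
pose p A := coord [tuple d] ord0 (daddv_pi D W A).
have pE A : daddv_pi D W A = p A *: d.
  have : daddv_pi D W A \in <<[tuple d]>>%VS.
    by rewrite span_seq1 -Dline memv_pi.
  by move/coord_span=> {1}->; rewrite big_ord1.
have p0 A : A \in E -> A \in W <-> p A = 0.
  move=> EA; have EDW : A \in (D + W)%VS by rewrite sumDW.
  have dA := daddv_pi_add capDW EDW; split=> [WA | e]; last first.
    by rewrite -dA pE e scale0r add0r memv_pi.
  have : daddv_pi D W A \in (D :&: W)%VS.
    rewrite memv_cap memv_pi.
    have -> : daddv_pi D W A = A - daddv_pi W D A by rewrite -{2}dA addrK.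
    by rewrite memvB ?memv_pi.
  by rewrite capDW memv0 pE scaler_eq0 (negPf d0) orbF => /eqP.
exists (fun u v => p (wedge u v)); split.
- split=> [a x y z | a x y z | x].
  + by rewrite /p wedge_alternating_l !linearP.
  + by rewrite /p wedge_alternating_r !linearP.
  + by rewrite /p wedgexx !linear0.
- apply: contrapT => hn.
  have all0 x y : p (wedge x y) = 0.
    by apply: contrapT => /eqP nz; apply: hn; exists x, y.
  have : (E <= W)%VS.
    apply/span_subvP=> _ /allpairsP[[u v] /= [_ _ ->]].
    by apply/p0; [exact: wedge_ext2 | exact: all0].
  by move/dimvS; rewrite -dW ltnn.
- by move=> u v; apply: p0; exact: wedge_ext2.
Qed.

End LinearComplexes.

(** * Geometric hyperplanes containing two parallel classes *)

Section HyperplaneRelation.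
Local Open Scope ring_scope.
Variables (F : fieldType) (V : vectType F).
Implicit Types (x y z u v w : V) (M N : line V).

Lemma basis2_free (U : {vspace V}) x y :
  basis_of U [:: x; y] -> x != 0 /\ y \notin <[x]>%VS.
Proof.
move=> b; have fr := basis_free b; split.
  by apply: (free_not0 fr); rewrite inE eqxx.
have := fr; rewrite (perm_free (Y := [:: y; x])); last first.
  by rewrite (perm_catC [:: x] [:: y]).
by rewrite free_cons span_seq1 => /andP[].
Qed.

Lemma line_eq M N x y : basis_of M [:: x; y] -> x \in N -> y \in N -> M = N.
Proof.
move=> b Nx Ny; apply: val_inj; rewrite /= -(span_basis b).
by apply/span_basis/basis2_dimE => //; [exact: dim_line | exact: basis_free b].
Qed.

Lemma pencil_of M N x : M <> N -> x != 0 -> x \in M -> x \in N ->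
  is_pencil [set L : line V | (<[x]> <= L)%VS && (L <= M + N)%VS] /\
  \dim (M + N) = 3%N.
Proof.
move=> nMN x0 Mx Nx; suff d3 : \dim (M + N) = 3%N.
  split=> //; exists <[x]>%VS, (M + N)%VS; rewrite dim_vline x0; split=> //.
  by rewrite -memvE; exact: subvP (addvSl _ _) _ Mx.
have := dimv_sum_cap M N; rewrite !dim_line.
suff : \dim (M :&: N) = 1%N by lia.
apply/eqP; rewrite eqn_leq lt0n; apply/andP; split; last first.
  apply: contra x0; rewrite dimv_eq0 => /eqP e.
  by rewrite -memv0 -e memv_cap Mx.
rewrite leqNgt; apply/negP => gt1; apply: nMN; apply: val_inj => /=.
have e1 : (M :&: N)%VS = M.
  by apply/eqP; rewrite eqEdim capvSl dim_line.
have e2 : (M :&: N)%VS = N.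
  by apply/eqP; rewrite eqEdim capvSr dim_line.
by rewrite -{1}e1 e2.
Qed.

Variable K : set (line V).

(** Dependent vectors span no line, so they are related by convention. *)
Definition line_relation x y := forall M, basis_of M [:: x; y] -> K M.

Lemma line_relationP M x y : basis_of M [:: x; y] -> K M <-> line_relation x y.
Proof.
move=> b; split=> [KM N bN | /(_ M b)//].
by rewrite (_ : N = M) //; apply: val_inj => /=;
  rewrite -(span_basis b) -(span_basis bN).
Qed.

Lemma line_relation_total M x y : K M -> x \in M -> y \in M -> line_relation x y.
Proof. by move=> KM Mx My N bN; rewrite (line_eq bN Mx My). Qed.

Hypothesis hK : geometric_hyperplane K.

(** Linearity: if the lines xy and xz belong to K and differ, they share the pencil
    of x in the plane xyz, which K contains two elements of, hence all.
    Exchange: K has an element in that pencil. *)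
Lemma hyperplane_null_relation : null_relation line_relation.
Proof.
split=> [x M /basis2_free[_] | x y h M b | a x y z hy hz M b | x y z].
- by rewrite memv_line.
- by apply: h; rewrite (perm_basis (Y := [:: y; x])) //
    (perm_catC [:: x] [:: y]).
- have [x0 nx] := basis2_free b.
  have Mx : x \in M by apply: (basis_mem b); rewrite inE eqxx.
  have Mt : a *: y + z \in M by apply: (basis_mem b); rewrite !inE eqxx orbT.
  have conc w : line_relation x w -> w \in M -> w \notin <[x]>%VS -> K M.
    by move=> h Mw nw; apply: h; apply: basis2_dimE => //;
      [exact: dim_line | exact: free2_notin].
  have [xy | nxy] := boolP (y \in <[x]>%VS).
    have Mz : z \in M.
      rewrite -(addKr (a *: y) z) memvD // memvN memvZ //.
      by move/vlineP: xy => [k ->]; rewrite memvZ.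
    by apply: (conc z) => //; apply: contra nx => xz; rewrite memvD // memvZ.
  have [My | nMy] := boolP (y \in M); first exact: (conc y).
  have [xz | nxz] := boolP (z \in <[x]>%VS).
    have a0 : a != 0 by apply: contraNneq nx => ->; rewrite scale0r add0r.
    case/negP: nMy; suff : a *: y \in M by rewrite rpredZeq (negPf a0).
    rewrite -(addrK z (a *: y)) memvB //.
    by move/vlineP: xz => [k ->]; rewrite memvZ.
  have [My bMy] := free2_lineP (free2_notin x0 nxy).
  have [Mz bMz] := free2_lineP (free2_notin x0 nxz).
  have Myx : x \in My by apply: (basis_mem bMy); rewrite inE eqxx.
  have Mzx : x \in Mz by apply: (basis_mem bMz); rewrite inE eqxx.
  have Myy : y \in My by apply: (basis_mem bMy); rewrite !inE eqxx orbT.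
  have Mzz : z \in Mz by apply: (basis_mem bMz); rewrite !inE eqxx orbT.
  have nMyM : My <> M by move=> e; rewrite -e Myy in nMy.
  have nMyz : My <> Mz.
    move=> e; apply: nMyM; apply/esym/(line_eq b) => //.
    by rewrite memvD ?memvZ // e.
  have [pP _] := pencil_of nMyM x0 Myx Mx.
  have sMz : (Mz <= My + M)%VS.
    rewrite -(span_basis bMz); apply/span_subvP=> w; rewrite !inE.
    case/orP=> /eqP->; first by exact: subvP (addvSl _ _) _ Myx.
    by rewrite -(addKr (a *: y) z) addrC memvB ?memvZ //;
      [exact: subvP (addvSr _ _) _ Mt | exact: subvP (addvSl _ _) _ Myy].
  case: (hK.2 _ pP) => [[L [_ uL]] | sP]; last first.
    by apply: sP; rewrite /= -memvE Mx addvSr.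
  case: nMyz; apply: (etrans (y := L)); [apply/esym|]; apply: uL.
    by split; [rewrite /= -memvE Myx addvSl | exact: hy].
  by split; [rewrite /= -memvE Mzx | exact: hz].
- have [-> | x0] := eqVneq x 0.
    by exists 1, 0; rewrite oner_eq0; split=> // M /basis2_free[]; rewrite eqxx.
  have [xy | nxy] := boolP (y \in <[x]>%VS).
    exists 1, 0; rewrite oner_eq0 scale1r scale0r addr0; split=> // M.
    by case/basis2_free=> _; rewrite xy.
  have [xz | nxz] := boolP (z \in <[x]>%VS).
    exists 0, 1; rewrite oner_eq0 orbT scale1r scale0r add0r; split=> // M.
    by case/basis2_free=> _; rewrite xz.
  have [My bMy] := free2_lineP (free2_notin x0 nxy).
  have [Mz bMz] := free2_lineP (free2_notin x0 nxz).
  have Myx : x \in My by apply: (basis_mem bMy); rewrite inE eqxx.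
  have Mzx : x \in Mz by apply: (basis_mem bMz); rewrite inE eqxx.
  have Mzz : z \in Mz by apply: (basis_mem bMz); rewrite !inE eqxx orbT.
  have [Myz | nMyz] := pselect (My = Mz).
    have /(basis2_mem _ bMy)[p [q e]] : z \in My by rewrite Myz.
    exists (- q), 1; rewrite oner_eq0 orbT scale1r; split=> // M.
    case/basis2_free=> _; rewrite e addrCA scaleNr addNr addr0.
    by rewrite memvZ ?memv_line.
  have [pP _] := pencil_of nMyz x0 Myx Mzx.
  have [L [pL KL]] : exists L : line V, (<[x]> <= L <= My + Mz)%VS /\ K L.
    case: (hK.2 _ pP) => [[L [[pL KL] _]] | sP]; first by exists L.
    exists My; rewrite -memvE Myx addvSl; split=> //.
    by apply: sP; rewrite /= -memvE Myx addvSl.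
  case/andP: pL; rewrite -memvE => Lx sL.
  have [t bL] := plane_basis_from (dim_line L) x0 Lx.
  have Lt : t \in L by apply: (basis_mem bL); rewrite !inE eqxx orbT.
  have /memv_addP[u Myu [v Mzv et]] := subvP sL _ Lt.
  have /(basis2_mem _ bMy)[p [q eu]] := Myu.
  have /(basis2_mem _ bMz)[r [s ev]] := Mzv.
  exists q, s; split; last first.
    apply: (line_relation_total KL Lx).
    have -> : q *: y + s *: z = t - (p + r) *: x.
      rewrite et eu ev scalerDl opprD addrACA.
      by rewrite [p *: x + _]addrC addrK [r *: x + _]addrC addrK.
    by rewrite memvB ?memvZ.
  have [_] := basis2_free bL; apply: contraNT; rewrite negb_or !negbK.
  case/andP=> /eqP q0 /eqP s0.
  by rewrite et eu ev q0 s0 !scale0r !addr0 -scalerDl memvZ ?memv_line.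
Qed.

Lemma hyperplane_not_total : exists x y, ~ line_relation x y.
Proof.
apply: contrapT => h; case: hK => nT _; apply: nT.
rewrite predeqE => M; split=> // _.
have [x [y b]] := plane_basis (dim_line M).
by apply/(line_relationP b); apply: contrapT => nr; apply: h; exists x, y.
Qed.

End HyperplaneRelation.

Section Complexes.
Local Open Scope ring_scope.
Import VectorInternalTheory.
Variables (F : fieldType) (V : vectType F).
Hypothesis hV : \dim {:V} = 4%N.
Variables (par : line V -> line V -> Prop) (hpar : parallelism par).
Implicit Types (x y z u v w : V) (M N : line V).

(** The vectors related to x form a proper subspace containing the
    three-dimensional sum N1 + N2. *)
Lemma polar_plane (R : V -> V -> Prop) M1 M2 N1 N2 x y :
    null_relation R -> radical_free R -> ~ par M1 M2 ->
    (forall N u v, par M1 N -> u \in N -> v \in N -> R u v) ->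
    (forall N u v, par M2 N -> u \in N -> v \in N -> R u v) ->
    par M1 N1 -> par M2 N2 -> x != 0 -> x \in N1 -> x \in N2 ->
  R x y <-> y \in (N1 + N2)%VS.
Proof.
move=> nR ndR nM t1 t2 p1 p2 x0 x1 x2.
have Rs t : t \in (N1 + N2)%VS -> R x t.
  case/memv_addP=> u N1u [v N2v ->]; apply: nullD => //.
    exact: t1 p1 _ _.
  exact: t2 p2 _ _.
split=> [Rxy | /Rs//]; apply: contraT => ny; have [z nz] := ndR x x0; case: nz.
have nN : N1 <> N2.
  by move=> e; apply: nM; apply: par_trans p1 _ => //; rewrite e; exact: par_sym.
have [_ d3] := pencil_of nN x0 x1 x2.
have e : (N1 + N2 + <[y]> = fullv)%VS.
  apply/eqP; rewrite eqEdim subvf hV ltnNge; apply/negP => le3.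
  have : (N1 + N2 == N1 + N2 + <[y]>)%VS by rewrite eqEdim addvSl d3.
  move/eqP => e; case/negP: ny; rewrite e.
  exact: subvP (addvSr _ _) _ (memv_line y).
have : z \in (N1 + N2 + <[y]>)%VS by rewrite e memvf.
case/memv_addP=> u Nu [_ /vlineP[k ->] ->].
by apply: nullD => //; [exact: Rs | exact: nullZ].
Qed.

Lemma plucker_relation (p q r s : {scalar V}) u v :
  let m (f g : {scalar V}) := f u * g v - g u * f v in
  m p q * m r s - m p r * m q s + m p s * m q r = 0.
Proof. by move=> m; rewrite /m; ring. Qed.

Lemma minor_functional (p q : {scalar V}) :
  exists L : 'Hom(_, F^o), forall u v, L (wedge u v) = p u * q v - q u * p v.
Proof.
by apply: alternating_functional; split=> [a x y z | a x y z | x];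
  rewrite ?linearP /=; ring.
Qed.

(** If N belongs to the complex and misses the axis A, the line joining the
    points A and N of the exterior square lies in W without being tangent: it
    contains the second point N of the quadric, and the sum of the two bivectors
    violates the Pluecker relation. *)
Lemma special_complex_not_spread K M :
  special_complex K -> ~ (forall N, par M N -> K N).
Proof.
case=> W [[hW _]] [q [[A _ <-] qW tan]] -> sK.
have [N /sK KN dj] := disjoint_parallel hpar M hV (dim_line A).
have [a1 [a2 bA]] := plane_basis (dim_line A).
have [n1 [n2 bN]] := plane_basis (dim_line N).
have /(mem_complex _ bN) WN := KN.
have fr : free [:: a1; a2; n1; n2].
  rewrite -[[:: _; _; _; _]]/([:: a1; a2] ++ [:: n1; n2]) cat_free.
  rewrite (basis_free bA) (basis_free bN) /=; apply/directv_addP.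
  rewrite (span_basis bA) (span_basis bN); apply/eqP; rewrite -subv0.
  by apply/subvP=> x; rewrite memv_cap memv0 => /andP[Ax Nx]; apply/eqP/dj.
have [p [r [s [t [dec coo]]]]] := vec4_coord hV fr.
have [pa1 ra1 sa1 ta1] : [/\ p a1 = 1, r a1 = 0, s a1 = 0 & t a1 = 0].
  by have := coo 1 0 0 0; rewrite /vec4 !scale0r !addr0 scale1r.
have [pa2 ra2 sa2 ta2] : [/\ p a2 = 0, r a2 = 1, s a2 = 0 & t a2 = 0].
  by have := coo 0 1 0 0; rewrite /vec4 !scale0r !addr0 add0r scale1r.
have [pn1 rn1 sn1 tn1] : [/\ p n1 = 0, r n1 = 0, s n1 = 1 & t n1 = 0].
  by have := coo 0 0 1 0; rewrite /vec4 !scale0r !addr0 !add0r scale1r.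
have [pn2 rn2 sn2 tn2] : [/\ p n2 = 0, r n2 = 0, s n2 = 0 & t n2 = 1].
  by have := coo 0 0 0 1; rewrite /vec4 !scale0r !add0r scale1r.
have [L12 E12] := minor_functional p r; have [L34 E34] := minor_functional s t.
have [L13 E13] := minor_functional p s; have [L24 E24] := minor_functional r t.
have [L14 E14] := minor_functional p t; have [L23 E23] := minor_functional r s.
set wa := wedge a1 a2; set wn := wedge n1 n2.
have eA : plucker A = <[wa]>%VS by exact: plucker_basis.
have eN : plucker N = <[wn]>%VS by exact: plucker_basis.
have wa0 : wa != 0.
  apply/eqP => e; have := E12 a1 a2; rewrite -/wa e linear0 pa1 ra1 ra2 pa2.
  by rewrite mulr1 mulr0 subr0 => /esym/eqP; rewrite oner_eq0.
have nwn : wn \notin <[wa]>%VS.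
  apply/negP=> /vlineP[k e]; have := E34 n1 n2; rewrite -/wn e linearZ /= E34.
  rewrite sn1 tn1 sn2 tn2 sa1 ta1 sa2 ta2 !mul0r subrr scaler0 subr0 mulr1.
  by move/esym/eqP; rewrite oner_eq0.
have wan0 : wa + wn != 0.
  apply: contra nwn; rewrite addrC addr_eq0 => /eqP->.
  by rewrite memvN memv_line.
have [||| _ _ _ [uniq | all]] := tan (<[wa]> + <[wn]>)%VS.
- have := dimv_sum_cap <[wa]> <[wn]>; rewrite !dim_vline wa0.
  have -> : wn != 0 by apply: contraNneq nwn => ->; rewrite mem0v.
  suff -> : (<[wa]> :&: <[wn]> = 0)%VS by rewrite dimv0 addn0.
  apply/eqP; rewrite -subv0; apply/subvP=> w; rewrite memv_cap memv0.
  case/andP=> wA /vlineP[k ek]; move: wA; rewrite ek rpredZeq (negPf nwn) orbF.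
  by move/eqP->; rewrite scale0r.
- by rewrite eA addvSl.
- by rewrite -eA subv_add qW -memvE.
- have := uniq (plucker N); rewrite eN addvSr => /(_ _ isT) e.
  case/negP: nwn; rewrite -eA -e ?memv_line //.
  by exists N.
- have [] := all <[wa + wn]>%VS.
  + by rewrite dim_vline wan0.
  + by rewrite -memvE memv_add ?memv_line.
  move=> M' _; have [u [v bM]] := plane_basis (dim_line M').
  rewrite (plucker_basis bM) => e.
  have : wa + wn \in <[wedge u v]>%VS by rewrite e memv_line.
  case/vlineP=> k ek.
  have := plucker_relation p r s t u v; rewrite /= -E12 -E13 -E14 -E23 -E24 -E34.
  move/(congr1 ( *%R (k * k))); rewrite mulr0.
  have -> : k * k * (L12 (wedge u v) * L34 (wedge u v)
      - L13 (wedge u v) * L24 (wedge u v) + L14 (wedge u v) * L23 (wedge u v)) =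
    L12 (k *: wedge u v) * L34 (k *: wedge u v)
      - L13 (k *: wedge u v) * L24 (k *: wedge u v)
      + L14 (k *: wedge u v) * L23 (k *: wedge u v).
    by rewrite !linearZ /= /GRing.scale /=; ring.
  have LD (L : 'Hom(_, F^o)) :
      L (wa + wn) = L (wedge a1 a2) + L (wedge n1 n2) by exact: linearD.
  rewrite -ek !LD !E12 !E34 !E13 !E24 !E14 !E23.
  rewrite pa1 pa2 pn1 pn2 ra1 ra2 rn1 rn2 sa1 sa2 sn1 sn2 ta1 ta2 tn1 tn2.
  rewrite !(mul0r, mulr0, mulr1, subr0, addr0, add0r, subrr).
  by move/eqP; rewrite oner_eq0.
Qed.

Lemma complex_total (W : {vspace 'M[F]_(dim V)}) B M : alternating B ->
    (forall u v, wedge u v \in W <-> B u v = 0) ->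
    (forall N, par M N -> complex_of W N) ->
  forall N u v, par M N -> u \in N -> v \in N -> B u v = 0.
Proof.
move=> altB BE sW N u v p Nu Nv; have KN := sW N p.
have [fr | nfr] := boolP (free [:: u; v]).
  have b : basis_of N [:: u; v] by apply: basis2_dimE => //; exact: dim_line.
  by apply/BE/(mem_complex _ b).
have [-> | u0] := eqVneq u 0; first exact: alt0l altB _.
have /vlineP[k ->] : v \in <[u]>%VS.
  by apply: contraNT nfr; exact: free2_notin.
by rewrite (altZr altB) (altxx altB) mulr0.
Qed.

Lemma hyperplane_general_complex :
  (forall C1 C2 : set (line V),
    parallel_class par C1 -> parallel_class par C2 -> C1 <> C2 ->
    exists H, geometric_hyperplane H /\ C1 `<=` H /\ C2 `<=` H) ->
  forall C1 C2 : set (line V),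
    parallel_class par C1 -> parallel_class par C2 -> C1 <> C2 ->
    exists K,
      unique (fun K' => [/\ linear_complex K', C1 `<=` K' & C2 `<=` K']) K
      /\ general_complex K.
Proof.
move=> hb C1 C2 c1 c2 nC; have [H [hH [s1 s2]]] := hb C1 C2 c1 c2 nC.
have [M1 e1] := c1; have [M2 e2] := c2.
have nM : ~ par M1 M2.
  move=> p; apply: nC; rewrite e1 e2 predeqE => N; split.
    by apply: par_trans => //; exact: par_sym.
  exact: par_trans.
have nR := hyperplane_null_relation hH.
have tot1 N u v : par M1 N -> u \in N -> v \in N -> line_relation H u v.
  by move=> p; apply: line_relation_total; apply: s1; rewrite e1.
have tot2 N u v : par M2 N -> u \in N -> v \in N -> line_relation H u v.
  by move=> p; apply: line_relation_total; apply: s2; rewrite e2.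
have ndR := spread_radical_free nR hV hpar tot1 (hyperplane_not_total hH).
have [B altB BE] := null_relation_alternating hV nR ndR.
have [|W hW WE] := alternating_complex altB.
  have [x [y nxy]] := hyperplane_not_total hH; exists x, y.
  by apply/eqP => /BE.
have HE : H = complex_of W.
  rewrite predeqE => M; have [x [y b]] := plane_basis (dim_line M).
  by rewrite (mem_complex _ b) WE -BE; exact: line_relationP.
have cH : linear_complex H by exists W.
exists H; split; last first.
  split=> // spH; apply: (special_complex_not_spread (M := M1) spH) => N p.
  by apply: s1; rewrite e1.
split=> // K' [[W' hW' eK'] s1' s2'].
have [B' [altB' nB' BE']] := complex_alternating hW'.
have nR' := alternating_null altB'.
have tot1' : forall N u v, par M1 N -> u \in N -> v \in N -> B' u v = 0.
  by apply: complex_total altB' BE' _ => N p; rewrite -eK'; apply: s1'; rewrite e1.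
have tot2' : forall N u v, par M2 N -> u \in N -> v \in N -> B' u v = 0.
  by apply: complex_total altB' BE' _ => N p; rewrite -eK'; apply: s2'; rewrite e2.
have ndR' : radical_free (fun x y => B' x y = 0).
  apply: (spread_radical_free nR' hV hpar tot1').
  by have [x [y /eqP nxy]] := nB'; exists x, y.
rewrite predeqE => M; have [x [y b]] := plane_basis (dim_line M).
have [x0 _] := basis2_free b.
have [N1 p1 x1] := par_line hpar M1 x0; have [N2 p2 x2] := par_line hpar M2 x0.
rewrite (line_relationP _ b) eK' (mem_complex _ b) BE'.
rewrite (polar_plane _ nR ndR nM tot1 tot2 p1 p2 x0 x1 x2).
by rewrite (polar_plane _ nR' ndR' nM tot1' tot2' p1 p2 x0 x1 x2).
Qed.

End Complexes.

(** * Clifford parallelisms have enough geometric hyperplanes *)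

Section QuadraticAlgebras.
Local Open Scope ring_scope.
Variables (F : fieldType) (H : falgType F).
Hypothesis divH : division_algebra H.
Implicit Types (h k u v w : H) (U A : {vspace H}).

Lemma limg_amull_comp u v U : (amull u @: (amull v @: U) = amull (u * v) @: U)%VS.
Proof.
by rewrite -limg_comp; congr (_ @: _)%VS; apply/lfunP => w;
  rewrite comp_lfunE !lfunE /= mulrA.
Qed.

Lemma limg_amulr_comp u v U : (amulr u @: (amulr v @: U) = amulr (v * u) @: U)%VS.
Proof.
by rewrite -limg_comp; congr (_ @: _)%VS; apply/lfunP => w;
  rewrite comp_lfunE !lfunE /= mulrA.
Qed.

Lemma limg_amull1 U : (amull 1 @: U = U)%VS.
Proof. by rewrite amull1 lim1g. Qed.

Lemma limg_amulr1 U : (amulr 1 @: U = U)%VS.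
Proof.
rewrite -[RHS]lim1g; congr (_ @: _)%VS; apply/lfunP => w.
by rewrite id_lfunE lfunE /= mulr1.
Qed.

Lemma dim_amull u U : u != 0 -> \dim (amull u @: U) = \dim U.
Proof.
by move=> u0; apply: limg_dim_eq; rewrite (eqP (lker0_amull (divH u0))) capv0.
Qed.

Lemma dim_amulr u U : u != 0 -> \dim (amulr u @: U) = \dim U.
Proof.
by move=> u0; apply: limg_dim_eq; rewrite (eqP (lker0_amulr (divH u0))) capv0.
Qed.

Definition quadratic := forall h, exists a b : F, h * h = a *: 1 + b *: h.

(** If 1, h, h^2 were independent, their span S would meet its translate k S for
    every k by dimension; then k is a quotient of two elements commuting with h,
    so h is central, hence a scalar. *)
Lemma quadratic_A : condition_A H -> quadratic.
Proof.
case=> _ Z1 d4 h; apply/mem_span2; apply: contraT => nq.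
have fr1 : free [:: 1; h].
  apply: free2_notin; first exact: oner_neq0.
  apply: contra nq => /vlineP[k ->]; apply/mem_span2; exists (k * k), 0.
  by rewrite scale0r addr0 -scalerAl mul1r scalerA.
have fr : free [:: h * h; 1; h] by rewrite free_cons nq.
have comm (s : H) : s \in <<[:: (h * h)%R; 1%R; h]>>%VS -> s * h = h * s.
  case/mem_span3=> a [b [c ->]].
  by rewrite !mulrDl !mulrDr -!scalerAl -!scalerAr mul1r mulr1 mulrA.
have hZ k : h * k = k * h.
  have [-> | k0] := eqVneq k 0; first by rewrite mulr0 mul0r.
  have := @exists_capv _ _ <<[:: (h * h)%R; 1%R; h]>>%VS
    (amull k @: <<[:: (h * h)%R; 1%R; h]>>)%VS fullv (subvf _) (subvf _).
  rewrite dim_amull // (eqP fr) d4 => /(_ isT)[s [s0 Ss]].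
  case/memv_imgP=> t St; rewrite lfunE /= => es.
  have t0 : t != 0 by apply: contraNneq s0 => t0; rewrite es t0 mulr0.
  apply: (mulIr (divH t0)).
  by rewrite -!mulrA -es -(comm t St) mulrA -es (comm s Ss).
have : h \in 'Z({:H})%VS.
  by rewrite memv_cap memvf; apply/centvP => k _; exact: hZ.
rewrite Z1 => /vlineP[k e]; case/negP: nq.
by apply/mem_span2; exists 0, k; rewrite scale0r add0r {1}e -scalerAl mul1r.
Qed.

Lemma quadratic_B : condition_B H -> quadratic.
Proof.
case=> _ _ _ sq h; have /vlineP[k e] := sq h.
by exists k, 0; rewrite scale0r addr0 -e.
Qed.

Hypothesis quadH : quadratic.

Lemma quadratic_mul A u v : \dim A = 2%N -> 1 \in A -> u \in A -> v \in A ->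
  u * v \in A.
Proof.
move=> dA A1; have [a b] := plane_basis_from dA (oner_neq0 _) A1.
have Aa : a \in A by apply: (basis_mem b); rewrite !inE eqxx orbT.
move=> /(basis2_mem _ b)[p [q ->]] /(basis2_mem _ b)[r [s ->]].
rewrite !mulrDl !mulrDr -!scalerAl -!scalerAr !mul1r !mulr1.
have [k [l ->]] := quadH a.
by rewrite !memvD ?memvZ // memvD ?memvZ.
Qed.

(** The subspace x^-1 U contains 1 and is two-dimensional, hence is a subfield A;
    and z = x w with w in A gives z^-1 U = w^-1 A = A. *)
Lemma quadratic_subfield_l U x z : \dim U = 2%N -> x != 0 -> z != 0 ->
  x \in U -> z \in U -> (amull (x^-1)%R @: U = amull (z^-1)%R @: U)%VS.
Proof.
move=> dU x0 z0 Ux Uz; have Ix := divH x0; have Iz := divH z0.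
set A := (amull (x^-1)%R @: U)%VS.
have dA : \dim A = 2%N by rewrite dim_amull // invr_neq0.
have A1 : 1 \in A.
  by apply/memv_imgP; exists x => //; rewrite lfunE /= mulVr.
have Aw : x^-1 * z \in A by apply/memv_imgP; exists z => //; rewrite lfunE.
have w0 : x^-1 * z != 0.
  by apply: contraNneq z0 => e; rewrite -(mulVKr Ix z) e mulr0.
have eA : (amull (x^-1 * z) @: A)%VS = A.
  apply/eqP; rewrite eqEdim dim_amull // leqnn andbT.
  apply/subvP=> _ /memv_imgP[v Av ->]; rewrite lfunE /=.
  exact: quadratic_mul.
have eU : U = (amull x @: A)%VS.
  by rewrite limg_amull_comp divrr // limg_amull1.
rewrite [in RHS]eU limg_amull_comp.
have -> : z^-1 * x = (x^-1 * z)^-1 by rewrite invrM ?unitrV // invrK.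
by rewrite -[in RHS]eA limg_amull_comp mulVr ?limg_amull1 //; exact: divH.
Qed.

Lemma quadratic_subfield_r U x z : \dim U = 2%N -> x != 0 -> z != 0 ->
  x \in U -> z \in U -> (amulr (x^-1)%R @: U = amulr (z^-1)%R @: U)%VS.
Proof.
move=> dU x0 z0 Ux Uz; have Ix := divH x0; have Iz := divH z0.
set A := (amulr (x^-1)%R @: U)%VS.
have dA : \dim A = 2%N by rewrite dim_amulr // invr_neq0.
have A1 : 1 \in A.
  by apply/memv_imgP; exists x => //; rewrite lfunE /= mulrV.
have Aw : z * x^-1 \in A by apply/memv_imgP; exists z => //; rewrite lfunE.
have w0 : z * x^-1 != 0.
  by apply: contraNneq z0 => e; rewrite -(mulrVK Ix z) e mul0r.
have eA : (amulr (z * x^-1) @: A)%VS = A.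
  apply/eqP; rewrite eqEdim dim_amulr // leqnn andbT.
  apply/subvP=> _ /memv_imgP[v Av ->]; rewrite lfunE /=.
  exact: quadratic_mul.
have eU : U = (amulr x @: A)%VS.
  by rewrite limg_amulr_comp mulVr // limg_amulr1.
rewrite [in RHS]eU limg_amulr_comp.
have -> : x * z^-1 = (z * x^-1)^-1 by rewrite invrM ?unitrV // invrK.
by rewrite -[in RHS]eA limg_amulr_comp mulrV ?limg_amulr1 //; exact: divH.
Qed.

End QuadraticAlgebras.

Section CliffordHyperplanes.
Local Open Scope ring_scope.
Variables (F : fieldType) (V H : vectType F).
Hypothesis hV : \dim {:V} = 4%N.
Implicit Types (x y z : V) (M N : line V).
Variables (par : line V -> line V -> Prop) (hpar : parallelism par).

(** The map m x stands for left, or right, division by x.  By hypothesis the image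
    of a line M under division by one of its points does not depend on the
    point, and is the same for parallel lines; the hyperplane consists of the
    lines whose image lies in a suitable P.  In the pencil of a point x in a plane
    Z, these are the lines inside the intersection of Z with the preimage of P. *)
Lemma translates_hyperplane (e : H) (m : V -> 'Hom(V, H)) :
    \dim {:H} = 4%N ->
    (forall x, x != 0 -> lker (m x) == 0%VS) ->
    (forall x, x != 0 -> m x x = e) ->
    (forall M N x y, par M N -> x != 0 -> y != 0 -> x \in M -> y \in N ->
       (m x @: M = m y @: N)%VS) ->
  forall C1 C2 : set (line V),
    parallel_class par C1 -> parallel_class par C2 ->
    exists H, geometric_hyperplane H /\ C1 `<=` H /\ C2 `<=` H.
Proof.
have ar k l : (3 < k -> k <= 4 -> k + l = 3 + 3 -> l = 2)%N by lia.
move=> dH kerm mx hm C1 C2 [M1 ->] [M2 ->].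
have dimm x (U : {vspace V}) : x != 0 -> \dim (m x @: U) = \dim U.
  by move=> x0; apply: limg_dim_eq; rewrite (eqP (kerm x x0)) capv0.
have ptM M : exists2 x, x != 0 & x \in M.
  have [x [y b]] := plane_basis (dim_line M); have [x0 _] := basis2_free b.
  by exists x => //; apply: (basis_mem b); rewrite inE eqxx.
have [x1 x10 Mx1] := ptM M1; have [x2 x20 Mx2] := ptM M2.
set L1 := (m x1 @: M1)%VS; set L2 := (m x2 @: M2)%VS.
have dL1 : \dim L1 = 2%N by rewrite dimm // dim_line.
have dL2 : \dim L2 = 2%N by rewrite dimm // dim_line.
have L1e : e \in L1 by rewrite -(mx x1 x10) memv_img.
have L2e : e \in L2 by rewrite -(mx x2 x20) memv_img.
have e0 : e != 0.
  by rewrite -(mx x1 x10) -(linear0 (m x1)) (inj_eq (lker0P (kerm _ x10))).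
have [P [dP sP1 sP2]] : exists P : {vspace H},
    [/\ \dim P = 3%N, (L1 <= P)%VS & (L2 <= P)%VS].
  (* L1 and L2 share e, so L1 needs only one more vector to contain L2. *)
  have [w nw sw] : exists2 w, w \notin L1 & (L2 <= L1 + <[w]>)%VS.
    have [s21 | /subvPn[w L2w nw]] := boolP (L2 <= L1)%VS.
      have [w nw] : exists w, w \notin L1 by apply: exists_notin; rewrite dL1 dH.
      by exists w => //; exact: subv_trans s21 (addvSl _ _).
    exists w => //; have b : basis_of L2 [:: e; w].
      apply: basis2_dimE => //; apply: free2_notin => //.
      by apply: contra nw => /vlineP[k ->]; rewrite memvZ.
    rewrite -(span_basis b); apply/span_subvP => t; rewrite !inE.
    case/orP=> /eqP->; first exact: subvP (addvSl _ _) _ L1e.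
    exact: subvP (addvSr _ _) _ (memv_line w).
  exists (L1 + <[w]>)%VS; rewrite addvSl; split=> //.
  have := dimv_sum_cap L1 <[w]>; rewrite dL1 dim_vline.
  have -> : w != 0 by apply: contraNneq nw => ->; rewrite mem0v.
  suff -> : (L1 :&: <[w]> = 0)%VS by rewrite dimv0 addn0.
  apply/eqP; rewrite -subv0; apply/subvP=> t; rewrite memv_cap memv0.
  case/andP=> L1t /vlineP[k ek]; move: L1t; rewrite ek rpredZeq (negPf nw) orbF.
  by move/eqP->; rewrite scale0r.
have Pe : e \in P by exact: subvP sP1 _ L1e.
pose K : set (line V) := [set M : line V |
  exists x, [/\ x != 0, x \in M & (m x @: M <= P)%VS]].
have KE M x : x != 0 -> x \in M -> K M <-> (m x @: M <= P)%VS.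
  move=> x0 Mx; split=> [[y [y0 My]] | h]; last by exists x.
  by rewrite (hm M M x y (par_refl hpar M) x0 y0 Mx My).
exists K; split; last first.
  split=> N /= p; have [y y0 Ny] := ptM N; apply/(KE N y) => //.
    by rewrite -(hm M1 N x1 y p x10 y0 Mx1 Ny).
  by rewrite -(hm M2 N x2 y p x20 y0 Mx2 Ny).
split=> [KT | _ [p [Z [dp dZ spZ ->]]]].
  have [y ny] : exists y, m x1 y \notin P.
    have : ~~ (m x1 @: fullv <= P)%VS.
      by apply/negP=> /dimvS; rewrite dimm // hV dP.
    by case/subvPn=> _ /memv_imgP[y _ ->]; exists y.
  have fr : free [:: x1; y].
    apply: free2_notin => //; apply: contra ny => /vlineP[k ->].
    by rewrite linearZ /= mx // memvZ.
  have [M bM] := free2_lineP fr.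
  have Mx : x1 \in M by apply: (basis_mem bM); rewrite inE eqxx.
  have My : y \in M by apply: (basis_mem bM); rewrite !inE eqxx orbT.
  have : K M by rewrite KT.
  move/(KE _ _ x10 Mx)/subvP/(_ (m x1 y) (memv_img _ My)).
  by rewrite (negPf ny).
have [x x0 ep] : exists2 x, x != 0 & p = <[x]>%VS.
  exists (vpick p); first by rewrite vpick0 -dimv_eq0 dp.
  apply/esym/eqP; rewrite eqEdim -memvE memv_pick dim_vline vpick0.
  by rewrite -dimv_eq0 dp.
rewrite {p dp}ep in spZ *; rewrite -memvE in spZ.
have [sZP | nZP] := boolP (m x @: Z <= P)%VS.
  right=> M /= /andP[]; rewrite -memvE => Mx sMZ; apply/(KE _ _ x0 Mx).
  exact: subv_trans (limgS _ sMZ) sZP.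
left; set D := (Z :&: (m x @^-1: P))%VS.
have dD : \dim D = 2%N.
  have dpre : \dim (m x @^-1: P) = 3%N.
    rewrite -(dimm x) // lpreimK ?dP //.
    have -> : limg (m x) = fullv; last exact: subvf.
    by apply/eqP; rewrite eqEdim subvf dimm // hV dH.
  have := dimv_sum_cap Z (m x @^-1: P); rewrite dZ dpre -/D.
  have sZ : (\dim Z < \dim (Z + m x @^-1: P))%N.
    rewrite ltnNge; apply: contra nZP => le.
    have e1 : (Z == Z + m x @^-1: P)%VS by rewrite eqEdim addvSl.
    have e2 : (m x @^-1: P == Z)%VS.
      by rewrite eqEdim dpre dZ andbT (eqP e1) addvSr.
    apply/subvP=> _ /memv_imgP[z Zz ->].
    by rewrite memv_preim (eqP e2).
  have := dimvS (subvf (Z + m x @^-1: P)); rewrite hV.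
  by move: sZ; rewrite dZ; exact: ar.
have Dx : x \in D by rewrite memv_cap spZ -memv_preim mx.
have dD' : \dim D == 2%N by rewrite dD.
exists (Line dD'); split.
  split; first by rewrite /= -memvE Dx capvSl.
  apply/(KE (Line dD') x x0 Dx) => /=; apply/subvP=> _ /memv_imgP[z Dz ->].
  by move: Dz; rewrite memv_cap -memv_preim => /andP[].
move=> M [] /= /andP[]; rewrite -memvE => Mx sMZ /(KE _ _ x0 Mx) sMP.
apply: val_inj; apply/esym/eqP; rewrite eqEdim /= dim_line dD andbT.
rewrite subv_cap sMZ; apply/subvP=> z Mz; rewrite -memv_preim.
by apply: subvP sMP _ _; exact: memv_img.
Qed.

End CliffordHyperplanes.

Section CliffordImpliesHyperplanes.
Local Open Scope ring_scope.
Variables (F : fieldType) (V : vectType F).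
Hypothesis hV : \dim {:V} = 4%N.
Variables (par : line V -> line V -> Prop) (hpar : parallelism par).

Lemma clifford_hyperplane : clifford par ->
  forall C1 C2 : set (line V),
    parallel_class par C1 -> parallel_class par C2 -> C1 <> C2 ->
    exists H, geometric_hyperplane H /\ C1 `<=` H /\ C2 `<=` H.
Proof.
case=> H [phi [bphi AB pE]] C1 C2 c1 c2 _.
have [divH dH quadH] : [/\ division_algebra H, \dim {:H} = 4%N & quadratic H].
  case: AB => hAB; split; try by case: hAB.
    by apply: quadratic_A => //; case: hAB.
  exact: quadratic_B.
have kphi : lker phi == 0%VS by apply/lker0P; exact: bij_inj.
have phi0 x : x != 0 -> phi x != 0.
  by move=> x0; rewrite -(linear0 phi) (inj_eq (lker0P kphi)).
have dphi (M : line V) : \dim (phi @: M) = 2%N.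
  by rewrite limg_dim_eq ?(eqP kphi) ?capv0 // dim_line.
case: pE => pE.
  apply: (@translates_hyperplane _ _ _ hV _ hpar 1
    (fun x => (amull ((phi x)^-1)%R \o phi)%VF) dH) c1 c2.
  - move=> x /phi0 x0; apply/lker0P => u v; rewrite !comp_lfunE => h.
    apply: (lker0P kphi); apply: (lker0P (lker0_amull _)) h.
    by rewrite unitrV; exact: divH.
  - by move=> x /phi0 x0; rewrite comp_lfunE lfunE /= mulVr //; exact: divH.
  move=> M N x y /pE[c c0 ecN] x0 y0 Mx Ny; rewrite !limg_comp.
  have : phi y \in (amull c @: (phi @: M))%VS by rewrite ecN memv_img.
  case/memv_imgP=> _ /memv_imgP[z Mz ->]; rewrite lfunE /= => ey.
  have z0 : z != 0.
    by apply: contraNneq (phi0 y y0) => z0; rewrite ey z0 linear0 mulr0.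
  rewrite -ecN ey limg_amull_comp invrM ?divH ?phi0 // mulrVK ?divH //.
  by apply: quadratic_subfield_l; rewrite ?phi0 ?memv_img.
apply: (@translates_hyperplane _ _ _ hV _ hpar 1
  (fun x => (amulr ((phi x)^-1)%R \o phi)%VF) dH) c1 c2.
- move=> x /phi0 x0; apply/lker0P => u v; rewrite !comp_lfunE => h.
  apply: (lker0P kphi); apply: (lker0P (lker0_amulr _)) h.
  by rewrite unitrV; exact: divH.
- by move=> x /phi0 x0; rewrite comp_lfunE lfunE /= mulrV //; exact: divH.
move=> M N x y /pE[c c0 ecN] x0 y0 Mx Ny; rewrite !limg_comp.
have : phi y \in (amulr c @: (phi @: M))%VS by rewrite ecN memv_img.
case/memv_imgP=> _ /memv_imgP[z Mz ->]; rewrite lfunE /= => ey.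
have z0 : z != 0.
  by apply: contraNneq (phi0 y y0) => z0; rewrite ey z0 linear0 mul0r.
rewrite -ecN ey limg_amulr_comp invrM ?divH ?phi0 // mulVKr ?divH //.
by apply: quadratic_subfield_r; rewrite ?phi0 ?memv_img.
Qed.

End CliffordImpliesHyperplanes.

(** * Division algebras of dimension four *)

Section FourDimensionalDivisionAlgebras.
Local Open Scope ring_scope.
Variables (F : fieldType) (H : falgType F).
Hypotheses (divH : division_algebra H) (dH : \dim {:H} = 4%N).
Implicit Types (u v w x y z a b h : H).

(** A relation among these elements expresses a as a quotient of two elements
    of F(z), which would make a central. *)
Lemma noncentral_free z a : z \notin (1%VS : {vspace H}) ->
  (forall w, w * z = z * w) -> (exists b, a * b != b * a) ->
  free [:: 1; z; a; z * a].
Proof.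
move=> nz cz [b nab]; apply/free4P => al be ga de e.
have cc p q w : w * (p *: 1 + q *: z) = (p *: 1 + q *: z) * w.
  by rewrite mulrDl mulrDr -!scalerAl -!scalerAr mul1r mulr1 cz.
have indep p q : p *: 1 + q *: z = 0 -> p = 0 /\ q = 0.
  have /free2P : free [:: 1; z] by apply: free2_notin => //; exact: oner_neq0.
  by apply.
have e1 : (ga *: 1 + de *: z) * a = - (al *: 1 + be *: z).
  apply/eqP; rewrite -addr_eq0 addrC mulrDl -!scalerAl mul1r addrA.
  exact/eqP.
have [gd | gd] := eqVneq (ga *: 1 + de *: z) 0.
  have [g0 d0] := indep _ _ gd; move: e1; rewrite gd mul0r => /esym/eqP.
  by rewrite oppr_eq0 => /eqP /indep[].
case/negP: nab; apply/eqP; apply: (mulrI (divH gd)).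
by rewrite mulrA e1 mulNr -cc -mulrN -e1 !mulrA cc.
Qed.

Lemma central_commutative z : z \notin (1%VS : {vspace H}) ->
  (forall w, w * z = z * w) -> commutative (@GRing.mul H).
Proof.
move=> nz cz a b; apply: contrapT => /eqP nab.
have fr : free [:: 1; z; a; z * a] by apply: noncentral_free => //; exists b.
case/negP: nab; apply/eqP.
have [p [q [r [s ->]]]] := free_span4 dH fr b.
rewrite !mulrDl !mulrDr -!scalerAl -!scalerAr mul1r mulr1 cz.
by rewrite mulrA cz.
Qed.

(** If H is commutative then 2 i j lies in the span of 1, i, j, which forces
    characteristic two and s = t = 0; squaring is then additive and maps
    the four basis elements into F.  If H is not commutative, its centre is F
    because a larger centre would make it commutative. *)
Lemma conditions_AB (i j : H) (t n s m r : F) :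
    free [:: 1; i; j; i * j] ->
    i * i = t *: i - n *: 1 -> j * j = s *: j - m *: 1 ->
    i * j + j * i = s *: i + t *: j - r *: 1 ->
  condition_A H \/ condition_B H.
Proof.
move=> fr ii jj ij; have [comm | ncomm] := pselect (commutative (@GRing.mul H)).
  right; split=> // h; rewrite expr2.
  have [r0 s0 t0 two] : [/\ r = 0, - s = 0, - t = 0 & 1 + 1 = 0 :> F].
    move/free4P: fr; apply; apply/eqP.
    have -> : r *: 1 + - s *: i + - t *: j + (1 + 1) *: (i * j) =
        (i * j + j * i) - (s *: i + t *: j - r *: 1).
      rewrite (comm j i) scalerDl scale1r opprD opprK opprD !scaleNr.
      by rewrite [RHS]addrC; congr (_ + _); rewrite [RHS]addrC addrA.
    by rewrite ij subrr.
  have s0' : s = 0 by rewrite -[s]opprK s0 oppr0.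
  have t0' : t = 0 by rewrite -[t]opprK t0 oppr0.
  have sqD x y : (x + y) * (x + y) = x * x + y * y.
    have xy0 : x * y + x * y = 0.
      by rewrite -[x * y]scale1r -scalerDl two scale0r.
    by rewrite mulrDl !mulrDr (comm y x) addrA -(addrA (x * x)) xy0 addr0.
  have sqZ k x : k *: x * (k *: x) = (k * k) *: (x * x).
    by rewrite -scalerAl -scalerAr scalerA.
  have [a [b [c [d ->]]]] := free_span4 dH fr h.
  have sqij : i * j * (i * j) = (i * i) * (j * j).
    by rewrite -mulrA (mulrA j) (comm j i) !mulrA.
  rewrite !sqD !sqZ sqij ii jj s0' t0' !scale0r !sub0r mulrNN mulr1.
  by rewrite -scalerAl mul1r !memvD ?memvZ ?memvN ?memvZ ?memv_line.
left; split=> //; apply/eqP; rewrite eqEsubv; apply/andP; split.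
  apply/subvP => z; rewrite memv_cap => /andP[_ /centvP cz].
  apply: contrapT => /negP nz; apply: ncomm; apply: central_commutative nz _.
  by move=> w; rewrite cz ?memvf.
rewrite -memvE memv_cap memvf; apply/centvP => w _.
by rewrite mul1r mulr1.
Qed.

(** The assumptions make right multiplication by i and j self-adjoint for B.
    A form with this property is determined by its row B 1 _, and that row
    vanishes at 1, i and j; so such forms are unique up to a scalar, and
    B (c x) (c y) is another one. *)
Lemma self_adjoint_invariant (i j : H) (B : H -> H -> F) (c : H) :
    free [:: 1; i; j; i * j] ->
    alternating B -> alternating (fun x y => B (x * i) y) ->
    alternating (fun x y => B (x * j) y) -> (exists x y, B x y != 0) ->
  c != 0 -> exists2 l, l != 0 & forall x y, B (c * x) (c * y) = l * B x y.
Proof.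
move=> fr altB altI altJ [x1 [y1 nB]] c0.
have vanish D : alternating D -> alternating (fun x y => D (x * i) y) ->
    alternating (fun x y => D (x * j) y) -> D 1 (i * j) = 0 ->
    forall x y, D x y = 0.
  move=> aD aI aJ e.
  have adI x y : D (x * i) y = D x (y * i).
    by rewrite (altN aI y x) /= -(altN aD).
  have adJ x y : D (x * j) y = D x (y * j).
    by rewrite (altN aJ y x) /= -(altN aD).
  have D1 y : D 1 y = 0.
    have [p [q [r [s ->]]]] := free_span4 dH fr y.
    rewrite !(altDr aD) !(altZr aD) e (altxx aD).
    have -> : D 1 i = 0 by have := altxx aI 1; rewrite /= mul1r (altN aD) => /eqP;
      rewrite oppr_eq0 => /eqP.
    have -> : D 1 j = 0 by have := altxx aJ 1; rewrite /= mul1r (altN aD) => /eqP;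
      rewrite oppr_eq0 => /eqP.
    by rewrite !mulr0 !addr0.
  have Di y : D i y = 0 by rewrite -[i]mul1r adI D1.
  have Dj y : D j y = 0 by rewrite -[j]mul1r adJ D1.
  move=> x y; have [p [q [r [s ->]]]] := free_span4 dH fr x.
  by rewrite !(altDl aD) !(altZl aD) D1 Di Dj adJ Di !mulr0 !addr0.
have d1 : B 1 (i * j) != 0.
  by apply: contraNneq nB => e; apply/eqP; exact: vanish.
(* The scalar that makes the difference of both sides vanish at 1, i j. *)
pose l := B c (c * (i * j)) / B 1 (i * j).
have inv x y : B (c * x) (c * y) = l * B x y.
  apply/eqP; rewrite -subr_eq0; apply/eqP.
  pose D x y := B (c * x) (c * y) - l * B x y.
  rewrite -/(D x y); apply: vanish; rewrite /D.
  - split=> [a u v w | a u v w | u].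
    + by rewrite mulrDr -scalerAr !(altDl altB) !(altZl altB); ring.
    + by rewrite mulrDr -scalerAr !(altDr altB) !(altZr altB); ring.
    + by rewrite !(altxx altB); ring.
  - split=> [a u v w | a u v w | u].
    + rewrite mulrDl mulrDr -!scalerAl -!scalerAr.
      by rewrite !(altDl altB) !(altZl altB); ring.
    + by rewrite mulrDr -scalerAr !(altDr altB) !(altZr altB); ring.
    + rewrite mulrA; have /= -> := altxx altI (c * u).
      by have /= -> := altxx altI u; ring.
  - split=> [a u v w | a u v w | u].
    + rewrite mulrDl mulrDr -!scalerAl -!scalerAr.
      by rewrite !(altDl altB) !(altZl altB); ring.
    + by rewrite mulrDr -scalerAr !(altDr altB) !(altZr altB); ring.
    + rewrite mulrA; have /= -> := altxx altJ (c * u).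
      by have /= -> := altxx altJ u; ring.
  - by rewrite mulr1 /l divfK // subrr.
exists l => //; apply: contra nB => /eqP l0.
have := inv (c^-1 * x1) (c^-1 * y1).
by rewrite !mulVKr ?divH // l0 mul0r => ->.
Qed.

End FourDimensionalDivisionAlgebras.

(** * The Pfaffian of a four by four matrix *)

Section AlternatingMatrices.
Local Open Scope ring_scope.
Variable F : fieldType.

Definition altmx a b c d e f : 'M[F]_4 :=
  \matrix_(i, j) nth 0 (nth [::] [:: [:: 0; a; b; c]; [:: - a; 0; d; e];
    [:: - b; - d; 0; f]; [:: - c; - e; - f; 0]] i) j.

Definition is_altmx (G : 'M[F]_4) := exists a b c d e f, G = altmx a b c d e f.

Definition pfaffian (G : 'M[F]_4) :=
  G ord0 (inord 1) * G (inord 2) (inord 3)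
  - G ord0 (inord 2) * G (inord 1) (inord 3)
  + G ord0 (inord 3) * G (inord 1) (inord 2).

Definition pfaffian_adjoint (G : 'M[F]_4) :=
  altmx (- G (inord 2) (inord 3)) (G (inord 1) (inord 3))
    (- G (inord 1) (inord 2)) (- G ord0 (inord 3))
    (G ord0 (inord 2)) (- G ord0 (inord 1)).

Lemma altmxE a b c d e f (G := altmx a b c d e f) :
  [/\ G ord0 (inord 1) = a, G ord0 (inord 2) = b & G ord0 (inord 3) = c] /\
  [/\ G (inord 1) (inord 2) = d, G (inord 1) (inord 3) = e &
      G (inord 2) (inord 3) = f].
Proof. by rewrite /G !mxE !inordK. Qed.

Lemma pfaffian_altmx a b c d e f :
  pfaffian (altmx a b c d e f) = a * f - b * e + c * d.
Proof.
by have [[h1 h2 h3] [h4 h5 h6]] := altmxE a b c d e f;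
  rewrite /pfaffian h1 h2 h3 h4 h5 h6.
Qed.

Lemma pfaffian_adjoint_altmx a b c d e f :
  pfaffian_adjoint (altmx a b c d e f) = altmx (- f) e (- d) (- c) b (- a).
Proof.
by have [[h1 h2 h3] [h4 h5 h6]] := altmxE a b c d e f;
  rewrite /pfaffian_adjoint h1 h2 h3 h4 h5 h6.
Qed.

Lemma altmxD a b c d e f a' b' c' d' e' f' :
  altmx a b c d e f + altmx a' b' c' d' e' f' =
  altmx (a + a') (b + b') (c + c') (d + d') (e + e') (f + f').
Proof.
by apply/matrixP => i j; rewrite !mxE;
  case: i => [[|[|[|[|]]]]] //= _; case: j => [[|[|[|[|]]]]] //= _;
  rewrite ?opprD ?addr0.
Qed.

Lemma pfaffian_adjointP G : is_altmx G ->
  G * pfaffian_adjoint G = (pfaffian G)%:M /\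
  pfaffian_adjoint G * G = (pfaffian G)%:M.
Proof.
case=> a [b [c [d [e [f ->]]]]].
rewrite pfaffian_altmx pfaffian_adjoint_altmx.
split; apply/matrixP => i j; rewrite !mxE !big_ord_recl big_ord0 !mxE -val_eqE;
  by case: i => [[|[|[|[|]]]]] //= _; case: j => [[|[|[|[|]]]]] //= _; ring.
Qed.

Definition pfaffian_polar G G' := pfaffian (G + G') - pfaffian G - pfaffian G'.

Lemma is_altmxD G G' : is_altmx G -> is_altmx G' -> is_altmx (G + G').
Proof.
case=> a [b [c [d [e [f ->]]]]] [a' [b' [c' [d' [e' [f' ->]]]]]].
by rewrite altmxD; do 6!eexists.
Qed.

Lemma pfaffian_adjointD G G' : is_altmx G -> is_altmx G' ->
  pfaffian_adjoint (G + G') = pfaffian_adjoint G + pfaffian_adjoint G'.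
Proof.
case=> a [b [c [d [e [f ->]]]]] [a' [b' [c' [d' [e' [f' ->]]]]]].
by rewrite altmxD !pfaffian_adjoint_altmx altmxD !opprD.
Qed.

Lemma pfaffian_polarP G G' : is_altmx G -> is_altmx G' ->
  G * pfaffian_adjoint G' + G' * pfaffian_adjoint G = (pfaffian_polar G G')%:M
  /\
  pfaffian_adjoint G * G' + pfaffian_adjoint G' * G = (pfaffian_polar G G')%:M.
Proof.
move=> aG aG'; have [h1 h2] := pfaffian_adjointP aG.
have [h1' h2'] := pfaffian_adjointP aG'.
have [k1 k2] := pfaffian_adjointP (is_altmxD aG aG').
rewrite pfaffian_adjointD // in k1 k2.
have zz (w x y z : 'M[F]_4) : w + x + (y + z) - w - z = x + y.
  by rewrite addrA [LHS]addrAC addrK -(addrA w) [LHS]addrAC subrr add0r.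
rewrite /pfaffian_polar !raddfB /= -k1 -h1 -h1'; split.
  by rewrite mulrDl !mulrDr zz.
rewrite k1 -k2 h1 h1' -h2 -h2'.
by rewrite mulrDl !mulrDr zz.
Qed.

Lemma pfaffian_neq0 G : is_altmx G -> G \is a GRing.unit -> pfaffian G != 0.
Proof.
move=> aG uG; apply/eqP => p0; have [_ h] := pfaffian_adjointP aG.
have z : pfaffian_adjoint G = 0.
  by apply: (mulIr uG); rewrite h p0 mul0r raddf0.
have G0 : G = 0.
  case: aG z => a [b [c [d [e [f ->]]]]]; rewrite pfaffian_adjoint_altmx => z.
  have [[h1 h2 h3] [h4 h5 h6]] := altmxE (- f) e (- d) (- c) b (- a).
  rewrite z !mxE in h1 h2 h3 h4 h5 h6.
  have oo (x : F) : 0 = - x -> x = 0 by move/eqP; rewrite eq_sym oppr_eq0 => /eqP.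
  rewrite -h2 -h5 (oo _ h1) (oo _ h3) (oo _ h4) (oo _ h6).
  by apply/matrixP => i j; rewrite !mxE;
    case: i => [[|[|[|[|]]]]] //= _; case: j => [[|[|[|[|]]]]] //= _;
    rewrite ?oppr0.
by move: uG; rewrite G0 unitr0.
Qed.

End AlternatingMatrices.

(** * The algebra generated by two quadratic matrices *)

Section QuadraticPair.
Local Open Scope ring_scope.
Variables (F : fieldType) (I J : 'M[F]_4) (t n s m r : F).
Hypotheses (hI : I * I = t *: I - n *: 1) (hJ : J * J = s *: J - m *: 1)
  (hIJ : I * J + J * I = s *: I + t *: J - r *: 1).
Hypothesis indep : forall x : 'rV[F]_4, x != 0 -> forall a b c,
  a *: x + b *: (x *m I) + c *: (x *m J) = 0 -> [/\ a = 0, b = 0 & c = 0].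

Lemma rowII (x : 'rV[F]_4) : x *m I *m I = t *: (x *m I) - n *: x.
Proof.
rewrite -mulmxA [I *m I]hI mulmxBr -!scalemxAr.
by rewrite -[1 : 'M[F]_4]/(1%:M) mulmx1.
Qed.

(** If a relation involves x I J, then with y = x (c + d I) it expresses y J by
    y and y I, because c + d I is invertible with inverse in <1, I>: its norm is
    nu.  This contradicts the independence of y, y I, y J. *)
Lemma row_free4 (x : 'rV[F]_4) a b c d : x != 0 ->
  a *: x + b *: (x *m I) + c *: (x *m J) + d *: (x *m I *m J) = 0 ->
  [/\ a = 0, b = 0, c = 0 & d = 0].
Proof.
move=> x0 e; have [d0 | d0] := eqVneq d 0.
  by move: e; rewrite d0 scale0r addr0 => /(indep x0)[-> -> ->].
pose xI := x *m I; pose y := c *: x + d *: xI.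
pose nu := c * c + c * d * t + d * d * n.
have y0 : y != 0.
  apply/eqP => yy; have := indep x0 (a := c) (b := d) (c := 0).
  by rewrite scale0r addr0 => /(_ yy)[_ /eqP]; rewrite (negPf d0).
have yI : y *m I = c *: xI + d *: (t *: xI - n *: x).
  by rewrite mulmxDl -!scalemxAl rowII.
have yJ : y *m J = c *: (x *m J) + d *: (xI *m J).
  by rewrite mulmxDl -!scalemxAl.
have xE : nu *: x = (c + d * t) *: y - d *: (y *m I).
  by rewrite yI /y /nu; apply/rowP => k; rewrite !mxE; ring.
have nu0 : nu != 0.
  apply/eqP => nu0; have := indep y0 (a := c + d * t) (b := - d) (c := 0).
  rewrite scale0r addr0 scaleNr -xE nu0 scale0r => /(_ erefl)[_ /eqP].
  by rewrite oppr_eq0 (negPf d0).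
have := indep y0 (a := a * (c + d * t) + b * d * n) (b := b * c - a * d) (c := nu).
case; last by move=> _ _ /eqP; rewrite (negPf nu0).
have -> : nu *: (y *m J) = - nu *: (a *: x + b *: xI).
  rewrite yJ; apply/eqP; rewrite scaleNr -addr_eq0 -scalerDr addrC addrA.
  by rewrite e scaler0.
by rewrite yI /y /nu; apply/rowP => k; rewrite !mxE; ring.
Qed.

Definition pair_space : {vspace 'M[F]_4} := <<[:: 1%R; I; J; (I * J)%R]>>%VS.

Let mem1 : 1 \in pair_space. Proof. by apply: memv_span; rewrite inE eqxx. Qed.
Let memI : I \in pair_space. Proof. by apply: memv_span; rewrite !inE eqxx !orbT. Qed.
Let memJ : J \in pair_space. Proof. by apply: memv_span; rewrite !inE eqxx !orbT. Qed.
Let memIJ : I * J \in pair_space.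
Proof. by apply: memv_span; rewrite !inE eqxx !orbT. Qed.

Lemma pair_space_mulI A : A \in pair_space -> A * I \in pair_space.
Proof.
have hJI : J * I = s *: I + t *: J - r *: 1 - I * J.
  by rewrite -hIJ addrC addKr.
case/mem_span4=> a [b [c [d ->]]]; rewrite !mulrDl -!scalerAl mul1r hI hJI.
rewrite -mulrA hJI !mulrDr !mulrN -!scalerAr mulr1 mulrA hI.
rewrite mulrDl mulNr -!scalerAl mul1r.
by do ?[exact: mem1 | exact: memI | exact: memJ | exact: memIJ |
  apply: memvD | apply: memvZ | rewrite memvN].
Qed.

Lemma pair_space_mulJ A : A \in pair_space -> A * J \in pair_space.
Proof.
case/mem_span4=> a [b [c [d ->]]]; rewrite !mulrDl -!scalerAl mul1r hJ.
rewrite -mulrA hJ mulrDr mulrN -!scalerAr mulr1.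
by do ?[exact: mem1 | exact: memI | exact: memJ | exact: memIJ |
  apply: memvD | apply: memvZ | rewrite memvN].
Qed.

Lemma pair_space_aspace : is_aspace pair_space.
Proof.
apply/andP; split; first exact: has_algid1 mem1.
apply/prodvP => A B LA /mem_span4[a [b [c [d ->]]]].
rewrite !mulrDr -!scalerAr mulr1 mulrA.
by do ?[apply: memvD | apply: memvZ]; rewrite ?pair_space_mulJ ?pair_space_mulI.
Qed.

Canonical pair_algebra := ASpace pair_space_aspace.
Local Notation L := (subvs_of pair_algebra).

(** A nonzero A in the span L annihilates no nonzero row, by [row_free4]; so L is a
    division algebra, and evaluation at a fixed row, here the first basis row,
    identifies L with the space of rows, right multiplication in L becoming
    the given action. *)
Lemma pair_algebra_model :
  exists (H : falgType F) (psi : 'Hom(H, 'rV[F]_4)) (i j : H),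
  [/\ lker psi == 0%VS /\ limg psi = fullv,
      division_algebra H /\ \dim {:H} = 4%N,
      free [:: 1; i; j; i * j],
      [/\ i * i = t *: i - n *: 1, j * j = s *: j - m *: 1 &
          i * j + j * i = s *: i + t *: j - r *: 1] &
      forall x, psi (x * i) = psi x *m I /\ psi (x * j) = psi x *m J].
Proof.
pose e : 'rV[F]_4 := delta_mx 0 0.
have e0 : e != 0.
  apply/eqP => /rowP/(_ 0); rewrite !mxE !eqxx /= => /eqP.
  by rewrite oner_eq0.
have inj (A : 'M[F]_4) (x : 'rV[F]_4) :
    x != 0 -> A \in pair_space -> x *m A = 0 -> A = 0.
  move=> x0 /mem_span4[a [b [c [d ->]]]].
  rewrite !mulmxDr -!scalemxAr -[1 : 'M[F]_4]/(1%:M) mulmx1.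
  rewrite -[I * J]/(I *m J) mulmxA => /(row_free4 x0)[-> -> -> ->].
  by rewrite !scale0r !addr0.
pose i : L := vsproj pair_algebra I; pose j : L := vsproj pair_algebra J.
have vi : vsval i = I by rewrite vsprojK.
have vj : vsval j = J by rewrite vsprojK.
have v1 : vsval (1 : L) = 1.
  by apply/eqP; rewrite [_ == _]algid_eq1.
have vM (x y : L) : vsval (x * y) = vsval x * vsval y by [].
have vD (x y : L) : vsval (x + y) = vsval x + vsval y by [].
have vZ k (x : L) : vsval (k *: x) = k *: vsval x by [].
have vN (x : L) : vsval (- x) = - vsval x by [].
pose f (x : L) : 'rV[F]_4 := e *m vsval x.
have lf : linear f by move=> a x y; rewrite /f vD vZ mulmxDr -scalemxAr.
pose fL : {linear L -> 'rV[F]_4} :=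
  HB.pack f (GRing.isLinear.Build _ _ _ _ f lf).
have fr : free [:: 1; i; j; i * j].
  apply/free4P => a b c d z; apply: (@row_free4 e) => //.
  have : f (a *: 1 + b *: i + c *: j + d *: (i * j)) = 0.
    by rewrite z; exact: (linear0 fL).
  rewrite /f !vD !vZ vM v1 vi vj !mulmxDr -!scalemxAr -[1 : 'M[F]_4]/(1%:M).
  by rewrite mulmx1 -[I * J]/(I *m J) mulmxA.
have dL : \dim {:L} = 4%N.
  apply/eqP; rewrite eqn_leq; apply/andP; split; last first.
    by have := dimvS (subvf <<[:: 1%R; i; j; (i * j)%R]>>%VS); rewrite (eqP fr).
  by rewrite dimvf; apply: leq_trans (dim_span _) _.
have kf : lker (linfun fL) == 0%VS.
  rewrite -subv0; apply/subvP => x; rewrite memv_ker lfunE memv0 => /eqP z.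
  by apply/eqP/subvs_inj; apply: (inj _ e) => //; exact: subvsP.
exists L, (linfun fL), i, j; split=> //.
- split=> //; apply/eqP; rewrite eqEdim subvf /= limg_dim_eq ?(eqP kf) ?capv0 //.
  by rewrite dL dimvf.
- split; last exact: dL.
  move=> h h0; apply: vsval_unitr; have := subvsP h; set A := vsval h => LA.
  have A0 : A != 0 by apply: contra h0 => /eqP z; apply/eqP/subvs_inj.
  rewrite -[_ \is a _]/(A \in unitmx) -row_free_unit -kermx_eq0.
  apply: contraNT A0 => k0; apply/eqP; apply: (inj _ (nz_row (kermx A))) => //.
    by rewrite nz_row_eq0.
  by apply/sub_kermxP; exact: nz_row_sub.
- split; apply: subvs_inj.
  + by rewrite vD vN !vZ vM v1 vi hI.
  + by rewrite vD vN !vZ vM v1 vj hJ.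
  + by rewrite !vD vN !vZ !vM v1 vi vj hIJ.
by move=> x; rewrite !lfunE /= /f !vM vi vj -!mulmxA.
Qed.

End QuadraticPair.

(** * The algebra of an anisotropic net of alternating forms *)

Section AnisotropicNet.
Local Open Scope ring_scope.
Variable F : fieldType.

Definition mxform (G : 'M[F]_4) (x y : 'rV[F]_4) : F := (x *m G *m y^T) 0 0.

Lemma mxform_alternating G : is_altmx G ->
  alternating (V := 'rV[F]_4) (mxform G).
Proof.
move=> aG; split=> [a x y z | a x y z | x].
- by rewrite /mxform !mulmxDl -!scalemxAl !mxE.
- by rewrite /mxform linearP /= mulmxDr -scalemxAr !mxE.
case: aG => a [b [c [d [e [f ->]]]]].
by rewrite /mxform !mxE !big_ord_recl !big_ord0 !mxE !big_ord_recl !big_ord0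
  !mxE /=; ring.
Qed.

(** Here I = G2 G1^-1 and J = G3 G1^-1, written with the Pfaffian adjoint of G1.
    The relations needed for [pair_algebra_model] come from exchanging
    ad G1 * Y for a scalar minus ad Y * G1. *)
Lemma anisotropic_net_algebra (G1 G2 G3 : 'M[F]_4) :
    is_altmx G1 -> is_altmx G2 -> is_altmx G3 ->
    (forall a b c, [|| a != 0, b != 0 | c != 0] ->
       a *: G1 + b *: G2 + c *: G3 \is a GRing.unit) ->
  exists (H : falgType F) (psi : 'Hom(H, 'rV[F]_4)),
  [/\ lker psi == 0%VS /\ limg psi = fullv,
      division_algebra H, condition_A H \/ condition_B H &
      forall c, c != 0 -> exists2 l, l != 0 & forall G, G \in [:: G1; G2; G3] ->
        forall x y, mxform G (psi (c * x)) (psi (c * y)) =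
                    l * mxform G (psi x) (psi y)].
Proof.
move=> a1 a2 a3 uG.
have u1 : G1 \is a GRing.unit.
  by have := uG 1 0 0; rewrite oner_eq0 scale1r !scale0r !addr0 => ->.
pose p1 := pfaffian G1; have p10 : p1 != 0 by exact: pfaffian_neq0.
pose ad := @pfaffian_adjoint F.
have [ad1 ad1'] := pfaffian_adjointP a1.
pose I := p1^-1 *: (G2 * ad G1); pose J := p1^-1 *: (G3 * ad G1).
have sM (k : F) : (k%:M : 'M[F]_4) = k *: 1 by rewrite -scalemx1.
have IG : I * G1 = G2.
  by rewrite -scalerAl -mulrA ad1' sM -scalerAr mulr1 scalerA mulVf // scale1r.
have JG : J * G1 = G3.
  by rewrite -scalerAl -mulrA ad1' sM -scalerAr mulr1 scalerA mulVf // scale1r.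
have swap X Y : is_altmx X -> is_altmx Y -> X * ad G1 * (Y * ad G1) =
    pfaffian_polar G1 Y *: (X * ad G1) - p1 *: (X * ad Y).
  move=> aX aY; have [_ h] := pfaffian_polarP a1 aY.
  have {}h : ad G1 * Y = pfaffian_polar G1 Y *: 1 - ad Y * G1.
    by rewrite -sM -h addrK.
  rewrite -mulrA (mulrA (ad G1)) h mulrBl mulrBr -!scalerAl mul1r -scalerAr.
  by rewrite -(mulrA (ad Y)) ad1 sM -!scalerAr mulr1.
pose t := pfaffian_polar G1 G2 / p1; pose s := pfaffian_polar G1 G3 / p1.
have sq (X Y : 'M[F]_4) : p1^-1 *: (X * ad G1) * (p1^-1 *: (Y * ad G1)) =
    (p1^-1 * p1^-1) *: (X * ad G1 * (Y * ad G1)).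
  by rewrite -scalerAl -scalerAr scalerA.
have hII : I * I = t *: I - (pfaffian G2 / p1) *: 1.
  rewrite /I sq swap // scalerBr !scalerA.
  rewrite (pfaffian_adjointP a2).1 sM scalerA /t.
  by congr (_ *: _ - _ *: _); field.
have hJJ : J * J = s *: J - (pfaffian G3 / p1) *: 1.
  rewrite /J sq swap // scalerBr !scalerA.
  rewrite (pfaffian_adjointP a3).1 sM scalerA /s.
  by congr (_ *: _ - _ *: _); field.
have hIJ : I * J + J * I = s *: I + t *: J - (pfaffian_polar G2 G3 / p1) *: 1.
  rewrite /I /J !sq !swap // !scalerBr !scalerA.
  rewrite addrACA -opprD; congr (_ + _ - _).
  - by congr (_ *: _); rewrite /s; field.
  - by congr (_ *: _); rewrite /t; field.
  - rewrite -scalerDr (pfaffian_polarP a2 a3).1 sM scalerA.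
    by congr (_ *: _); field.
clearbody I J.
have indep (x : 'rV[F]_4) : x != 0 -> forall a b c,
    a *: x + b *: (x *m I) + c *: (x *m J) = 0 -> [/\ a = 0, b = 0 & c = 0].
  move=> x0 a b c e; have [|] := boolP [|| a != 0, b != 0 | c != 0]; last first.
    by rewrite !negb_or !negbK => /and3P[/eqP-> /eqP-> /eqP->].
  move=> /uG ug; case/negP: x0; apply/eqP.
  have : x *m (a *: G1 + b *: G2 + c *: G3) = 0.
    rewrite -(mul0mx _ G1) -e -IG -JG -[I * G1]/(I *m G1) -[J * G1]/(J *m G1).
    by rewrite !mulmxDr !mulmxDl -!scalemxAr -!scalemxAl !mulmxA.
  by move/(congr1 (mulmx^~ (a *: G1 + b *: G2 + c *: G3)^-1));
    rewrite /= -mulmxA [_ *m _^-1]divrr // mulmx1 mul0mx.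
have [H [psi [i [j [bpsi [divH dH] fr [ii jj ij] mulpsi]]]]] :=
  pair_algebra_model hII hJJ hIJ indep.
exists H, psi; split=> //; first exact: conditions_AB fr ii jj ij.
move=> c c0; pose B (x y : H) := mxform G1 (psi x) (psi y).
have altG G : is_altmx G -> alternating (fun x y => mxform G (psi x) (psi y)).
  move=> /mxform_alternating altG; split=> [a x y z | a x y z | x].
  - by rewrite linearP (altDl altG) (altZl altG).
  - by rewrite linearP (altDr altG) (altZr altG).
  - exact: (altxx altG).
have eI x y : B (x * i) y = mxform G2 (psi x) (psi y).
  by rewrite /B (mulpsi x).1 /mxform -(mulmxA (psi x)) [I *m G1]IG.
have eJ x y : B (x * j) y = mxform G3 (psi x) (psi y).
  by rewrite /B (mulpsi x).2 /mxform -(mulmxA (psi x)) [J *m G1]JG.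
have [|||l l0 inv] := self_adjoint_invariant divH dH (B := B) fr (altG _ a1)
    _ _ _ c0.
- suff -> : (fun x y => B (x * i) y) = (fun x y => mxform G2 (psi x) (psi y)).
    exact: altG.
  by apply/funext => x; apply/funext => y.
- suff -> : (fun x y => B (x * j) y) = (fun x y => mxform G3 (psi x) (psi y)).
    exact: altG.
  by apply/funext => x; apply/funext => y.
- apply: contrapT => hn; have z x y : B x y = 0.
    by apply: contrapT => /eqP nz; apply: hn; exists x, y.
  have G10 : G1 = 0.
    apply/matrixP => k k'.
    have rK (u : 'rV[F]_4) : exists x, u = psi x.
      have : u \in limg psi by rewrite bpsi.2 memvf.
      by case/memv_imgP=> x _ ->; exists x.
    have [x ex] := rK (delta_mx 0 k); have [y ey] := rK (delta_mx 0 k').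
    have := z x y; rewrite /B -ex -ey /mxform -rowE trmx_delta -colE.
    by rewrite !mxE.
  by move: u1; rewrite G10 unitr0.
exists l => // G; rewrite !inE => /or3P[] /eqP-> x y.
- exact: inv.
- by rewrite -!eI -inv mulrA.
- by rewrite -!eJ -inv mulrA.
Qed.

End AnisotropicNet.

(** * The net of forms of a parallelism *)

Section NetOfForms.
Local Open Scope ring_scope.
Variables (F : fieldType) (V : vectType F).
Hypothesis hV : \dim {:V} = 4%N.
Variables (par : line V -> line V -> Prop) (hpar : parallelism par).
Implicit Types (x y z u v w : V) (M N : line V) (B : V -> V -> F).

Definition class_isotropic B M :=
  forall N u v, par M N -> u \in N -> v \in N -> B u v = 0.

Definition comb3 a b c (B1 B2 B3 : V -> V -> F) x y :=
  a * B1 x y + b * B2 x y + c * B3 x y.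

Lemma alternating_comb3 a b c B1 B2 B3 : alternating B1 -> alternating B2 ->
  alternating B3 -> alternating (comb3 a b c B1 B2 B3).
Proof.
move=> a1 a2 a3; split=> [k x y z | k x y z | x]; rewrite /comb3.
- by rewrite !(altDl a1, altDl a2, altDl a3, altZl a1, altZl a2, altZl a3); ring.
- by rewrite !(altPr a1, altPr a2, altPr a3); ring.
- by rewrite (altxx a1) (altxx a2) (altxx a3) !mulr0 !addr0.
Qed.

(** A form vanishing on a class is determined by its values B x _ at any nonzero
    vector x, as the difference of two such forms with equal values is zero. *)
Lemma class_isotropic_degenerate B M x :
  alternating B -> class_isotropic B M -> x != 0 ->
  (forall y, B x y = 0) -> forall u v, B u v = 0.
Proof.
move=> altB vB x0 Bx u v; apply: contrapT => nz.
have := spread_radical_free (alternating_null altB) hV hpar vB.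
by case/(_ (ex_intro _ u (ex_intro _ v nz)) x x0) => y; case.
Qed.

Hypothesis common_form : forall M1 M2, ~ par M1 M2 ->
  exists B, [/\ alternating B, exists x y, B x y != 0, class_isotropic B M1 &
    class_isotropic B M2].

Lemma not_par M N x y : x != 0 -> x \in M -> x \in N -> y \in M ->
  y \notin N -> ~ par M N.
Proof.
by move=> x0 Mx Nx My ny /(par_meet hpar)/(_ x0 Mx Nx) e; rewrite -e My in ny.
Qed.

(** The form common to the classes of <e0, b> and <e0, c>, scaled; its value at
    e0, a is nonzero, since e0 would otherwise be in its radical. *)
Lemma dual_form e0 a b c : free [:: e0; a; b; c] ->
  exists B, [/\ alternating B, [/\ B e0 a = 1, B e0 b = 0 & B e0 c = 0],
    forall M, e0 \in M -> b \in M -> class_isotropic B M &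
    forall M, e0 \in M -> c \in M -> class_isotropic B M].
Proof.
move=> fr; have /free4P ind := fr.
have e00 : e0 != 0 by apply: (free_not0 fr); rewrite inE eqxx.
have fb : free [:: e0; b].
  apply/free2P => p q e; have := ind p 0 q 0.
  by rewrite !scale0r !addr0 => /(_ e)[].
have fc : free [:: e0; c].
  apply/free2P => p q e; have := ind p 0 0 q.
  by rewrite !scale0r !addr0 => /(_ e)[].
have [Mb bMb] := free2_lineP fb; have [Mc bMc] := free2_lineP fc.
have Mbe : e0 \in Mb by apply: (basis_mem bMb); rewrite inE eqxx.
have Mbb : b \in Mb by apply: (basis_mem bMb); rewrite !inE eqxx orbT.
have Mce : e0 \in Mc by apply: (basis_mem bMc); rewrite inE eqxx.
have Mcc : c \in Mc by apply: (basis_mem bMc); rewrite !inE eqxx orbT.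
have npar : ~ par Mb Mc.
  apply: (not_par e00 Mbe Mce Mbb); apply/negP => /(basis2_mem _ bMc)[p [q e]].
  have := ind p 0 (-1) q; rewrite scale0r addr0 scaleN1r e.
  rewrite opprD addrA subrr add0r addNr => /(_ erefl)[_ _ /eqP].
  by rewrite oppr_eq0 oner_eq0.
have [B [altB [x [y nB]] vb vc]] := common_form npar.
have Beb : B e0 b = 0 by apply: (vb Mb) => //; exact: par_refl.
have Bec : B e0 c = 0 by apply: (vc Mc) => //; exact: par_refl.
have Bea : B e0 a != 0.
  apply: contra nB => /eqP ea; apply/eqP.
  apply: class_isotropic_degenerate vb e00 _ _ _ => //.
  move=> z; have [p [q [r [s ->]]]] := free_span4 hV fr z.
  rewrite !(altDr altB) !(altZr altB) ea Beb Bec (altxx altB).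
  by rewrite !mulr0 !addr0.
have alt' := alternating_comb3 (B e0 a)^-1 0 0 altB altB altB.
exists (comb3 (B e0 a)^-1 0 0 B B B); rewrite /comb3; split=> //.
- by rewrite Beb Bec mulVf // !mulr0 !mul0r !addr0.
- move=> M Me Mb' N u v p Nu Nv; suff -> : B u v = 0 by rewrite !mulr0 !addr0.
  by apply: (vb N) => //; rewrite (line_eq bMb Me Mb').
- move=> M Me Mc' N u v p Nu Nv; suff -> : B u v = 0 by rewrite !mulr0 !addr0.
  by apply: (vc N) => //; rewrite (line_eq bMc Me Mc').
Qed.

(** The form B common to the classes of M and <e0, a> is a combination of Bb and
    Bc, as both sides can be compared at e0; evaluating at the vector of M
    determines the ratio of the two coefficients. *)
Lemma cross_class_isotropic e0 a b c Bb Bc M p q r : free [:: e0; a; b; c] ->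
    alternating Bb -> alternating Bc ->
    [/\ Bb e0 a = 0, Bb e0 b = 1 & Bb e0 c = 0] ->
    [/\ Bc e0 a = 0, Bc e0 b = 0 & Bc e0 c = 1] ->
    (forall N, e0 \in N -> a \in N -> class_isotropic Bb N) ->
    (forall N, e0 \in N -> a \in N -> class_isotropic Bc N) ->
    e0 \in M -> p *: a + q *: b + r *: c \in M ->
  class_isotropic (fun x y => r * Bb x y - q * Bc x y) M.
Proof.
move=> fr altb altc [ba bb bc] [ca cb cc] vb vc Me Mv.
have [/andP[/eqP-> /eqP->] | nqr] := boolP ((q == 0) && (r == 0)).
  by move=> N u v *; rewrite !mul0r subr0.
have /free4P ind := fr.
have e00 : e0 != 0 by apply: (free_not0 fr); rewrite inE eqxx.
have fa : free [:: e0; a].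
  apply/free2P => k l e; have := ind k l 0 0.
  by rewrite !scale0r !addr0 => /(_ e)[].
have [Ma bMa] := free2_lineP fa.
have Mae : e0 \in Ma by apply: (basis_mem bMa); rewrite inE eqxx.
have Maa : a \in Ma by apply: (basis_mem bMa); rewrite !inE eqxx orbT.
have npar : ~ par M Ma.
  apply: (not_par e00 Me Mae Mv); apply: contra nqr => /(basis2_mem _ bMa)[k [l e]].
  have := ind (- k) (p - l) q r; case; last by move=> _ _ -> ->; rewrite eqxx.
  have h : (p - l) *: a + q *: b + r *: c = k *: e0.
    by rewrite scalerBl [X in X + _]addrAC [LHS]addrAC e addrK.
  by rewrite scaleNr -!addrA [X in _ + X]addrA h addNr.
have [B [altB [x [y nB]] vM vMa]] := common_form npar.
pose be := B e0 b; pose ga := B e0 c.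
have Bea : B e0 a = 0 by apply: (vMa Ma) => //; exact: par_refl.
have BE u v : B u v = be * Bb u v + ga * Bc u v.
  have alt' := alternating_comb3 1 (- be) (- ga) altB altb altc.
  suff : comb3 1 (- be) (- ga) B Bb Bc u v = 0.
    by rewrite /comb3 mul1r !mulNr -addrA -opprD => /subr0_eq.
  apply: (class_isotropic_degenerate (M := Ma) alt' _ e00).
    move=> N s t pN Ns Nt; rewrite /comb3 (vMa N) // (vb Ma Mae Maa N) //.
    by rewrite (vc Ma Mae Maa N) // !mulr0 !addr0.
  move=> z; have [k [l [s [t ->]]]] := free_span4 hV fr z.
  rewrite !(altDr alt') !(altZr alt') (altxx alt') /comb3 ba bb bc ca cb cc Bea.
  by rewrite -/be -/ga; ring.
have orth : q * be + r * ga = 0.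
  have := vM M e0 _ (par_refl hpar M) Me Mv.
  by rewrite !(altDr altB) !(altZr altB) Bea mulr0 add0r.
have [b0 | b0] := eqVneq be 0.
  have g0 : ga != 0.
    by apply: contra nB => /eqP g0; rewrite BE b0 g0 !mul0r addr0.
  move=> N u v pN Nu Nv; apply: (mulfI g0); rewrite mulr0.
  have -> : ga * (r * Bb u v - q * Bc u v) =
      (q * be + r * ga) * Bb u v - q * (be * Bb u v + ga * Bc u v) by ring.
  by rewrite -BE (vM N) // orth mul0r mulr0 subr0.
move=> N u v pN Nu Nv; apply: (mulfI b0); rewrite mulr0.
have -> : be * (r * Bb u v - q * Bc u v) =
    r * (be * Bb u v + ga * Bc u v) - (q * be + r * ga) * Bc u v by ring.
by rewrite -BE (vM N) // orth mul0r mulr0 subr0.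
Qed.

Lemma kernel_pair (a b : 'I_3 -> F) : exists k : 'I_3 -> F,
  [/\ exists i, k i != 0, \sum_i k i * a i = 0 & \sum_i k i * b i = 0].
Proof.
pose A : 'M[F]_(3, 2) := \matrix_(i, j) (if j == 0 then a i else b i).
have : kermx A != 0.
  rewrite -mxrank_eq0 mxrank_ker subn_eq0 -ltnNge.
  exact: leq_ltn_trans (rank_leq_col A) _.
rewrite -nz_row_eq0; set k := nz_row _ => k0.
have /sub_kermxP kA : (k <= kermx A)%MS by exact: nz_row_sub.
exists (fun i => k 0 i); split.
- by have /rV0Pn[i ki] := k0; exists i.
- have := congr1 (fun M : 'rV_2 => M 0 0) kA; rewrite !mxE => {2}<-.
  by apply: eq_bigr => i _; rewrite mxE.
- have := congr1 (fun M : 'rV_2 => M 0 1) kA; rewrite !mxE => {2}<-.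
  by apply: eq_bigr => i _; rewrite mxE.
Qed.

(** The forms B1, B2, B3 are dual to e1, e2, e3 at e0.  By
    [cross_class_isotropic], the class of the line <e0, p e1 + q e2 + r e3> is
    isotropic for all combinations of B1, B2, B3 with coefficients orthogonal
    to (p, q, r).  Every nonzero combination occurs for some class, which makes
    it nondegenerate; and the values (B1 y z, B2 y z, B3 y z) on a line of the
    class are proportional to (p, q, r), so they determine the class. *)
Theorem parallelism_net : exists (e : 4.-tuple V) (B1 B2 B3 : V -> V -> F),
  [/\ basis_of {:V} e, [/\ alternating B1, alternating B2 & alternating B3],
    forall a b c, [|| a != 0, b != 0 | c != 0] ->
      forall x, x != 0 -> exists y, comb3 a b c B1 B2 B3 x y != 0 &
    forall M N y z y' z' l, basis_of M [:: y; z] -> basis_of N [:: y'; z'] ->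
      l != 0 -> B1 y' z' = l * B1 y z -> B2 y' z' = l * B2 y z ->
      B3 y' z' = l * B3 y z -> par M N].
Proof.
have [e0 [e1 [e2 [e3 fr]]]] : exists e0 e1 e2 e3 : V, free [:: e0; e1; e2; e3].
  have : free (vbasis {:V}) by exact: basis_free (vbasisP _).
  have : size (vbasis {:V}) = 4%N by rewrite size_tuple hV.
  case: (vbasis {:V}) => [[|e0 [|e1 [|e2 [|e3 []]]]]] //= _ _ fr.
  by exists e0, e1, e2, e3.
have fr2 : free [:: e0; e2; e3; e1].
  rewrite (perm_free (Y := [:: e0; e1; e2; e3])) // perm_cons.
  by rewrite (perm_catC [:: e2; e3] [:: e1]).
have fr3 : free [:: e0; e3; e1; e2].
  rewrite (perm_free (Y := [:: e0; e1; e2; e3])) // perm_cons.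
  by rewrite (perm_catC [:: e3] [:: e1; e2]).
have e00 : e0 != 0 by apply: (free_not0 fr); rewrite inE eqxx.
have [B1 [a1 [b11 b12 b13] v12 v13]] := dual_form fr.
have [B2 [a2 [b22 b23 b21] v23 v21]] := dual_form fr2.
have [B3 [a3 [b33 b31 b32] v31 v32]] := dual_form fr3.
pose vec p q r : V := p *: e1 + q *: e2 + r *: e3.
have c1 M p q r : e0 \in M -> vec p q r \in M ->
    class_isotropic (fun x y => r * B2 x y - q * B3 x y) M.
  by move=> Me; apply: cross_class_isotropic fr _ _ _ _ _ _ Me.
have c2 M p q r : e0 \in M -> vec p q r \in M ->
    class_isotropic (fun x y => p * B3 x y - r * B1 x y) M.
  move=> Me Mv; apply: (@cross_class_isotropic e0 e2 e3 e1 _ _ M q r p) => //.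
  by rewrite addrC addrA.
have c3 M p q r : e0 \in M -> vec p q r \in M ->
    class_isotropic (fun x y => q * B1 x y - p * B2 x y) M.
  move=> Me Mv; apply: (@cross_class_isotropic e0 e3 e1 e2 _ _ M r p q) => //.
  by rewrite -addrA addrC.
have lineM p q r : [|| p != 0, q != 0 | r != 0] ->
    exists2 M : line V, e0 \in M & vec p q r \in M.
  move=> nz; have fv : free [:: e0; vec p q r].
    apply/free2P => k l e; have /free4P/(_ k (l * p) (l * q) (l * r)) := fr.
    have := e; rewrite /vec !scalerDr !scalerA !addrA => e' /(_ e')[-> lp lq lr].
    split=> //; apply/eqP; apply: contraLR nz => l0.
    rewrite !negb_or !negbK.
    move/eqP: lp; rewrite mulf_eq0 (negPf l0) /= => ->.
    move/eqP: lq; rewrite mulf_eq0 (negPf l0) /= => ->.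
    by move/eqP: lr; rewrite mulf_eq0 (negPf l0) /= => ->.
  have [M bM] := free2_lineP fv; exists M; apply: (basis_mem bM);
  by rewrite !inE eqxx ?orbT.
have aniso a b c : [|| a != 0, b != 0 | c != 0] ->
    forall x, x != 0 -> exists y, comb3 a b c B1 B2 B3 x y != 0.
  move=> nz x x0; apply: contrapT => hn.
  have Bx y : comb3 a b c B1 B2 B3 x y = 0.
    by apply: contrapT => /eqP h; apply: hn; exists y.
  have alt' := alternating_comb3 a b c a1 a2 a3.
  have [M vM] : exists M, class_isotropic (comb3 a b c B1 B2 B3) M.
    have [az | a0] := eqVneq a 0.
      have [|M Me Mv] := lineM 0 c (- b).
        by move: nz; rewrite az oppr_eq0 eqxx /= => /orP[] ->; rewrite ?orbT.
      exists M => N u v pN Nu Nv; rewrite /comb3 az.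
      have := c1 M _ _ _ Me Mv N u v pN Nu Nv => h.
      by apply/eqP; rewrite -oppr_eq0 -[X in _ == X]h; apply/eqP; ring.
    have [|M Me Mv] := lineM (- b) a 0; first by rewrite a0 orbT.
    exists M => N u v pN Nu Nv; rewrite /comb3; apply: (mulfI a0); rewrite mulr0.
    have h1 := c3 M _ _ _ Me Mv N u v pN Nu Nv.
    have h2 := c1 M _ _ _ Me Mv N u v pN Nu Nv.
    rewrite /= in h1 h2.
    transitivity (a * (a * B1 u v - - b * B2 u v) - c * (0 * B2 u v - a * B3 u v)).
      by ring.
    by rewrite h1 h2 !mulr0 subr0.
  have z := class_isotropic_degenerate alt' vM x0 Bx; move: nz.
  have := z e0 e1; rewrite /comb3 b11 b21 b31 mulr1 !mulr0 !addr0 => ->.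
  have := z e0 e2; rewrite /comb3 b12 b22 b32 mulr1 !mulr0 !addr0 add0r => ->.
  have := z e0 e3; rewrite /comb3 b13 b23 b33 mulr1 !mulr0 !add0r => ->.
  by rewrite eqxx.
(* If B1, B2, B3 all vanished at y, z, their values at y would be three
   functionals on the two-dimensional quotient by y, z, and a combination of the
   forms would be degenerate. *)
have nzp M y z : basis_of M [:: y; z] ->
    [|| B1 y z != 0, B2 y z != 0 | B3 y z != 0].
  move=> bM; apply: contrapT => /negP; rewrite !negb_or !negbK.
  case/and3P=> /eqP z1 /eqP z2 /eqP z3.
  have [y0 _] := basis2_free bM.
  have [t nt] : exists t, t \notin <<[:: y; z]>>%VS.
    by apply: exists_notin; rewrite hV; exact: leq_ltn_trans (dim_span _) _.
  have [w nw] : exists w, w \notin <<[:: t; y; z]>>%VS.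
    by apply: exists_notin; rewrite hV; exact: leq_ltn_trans (dim_span _) _.
  have frw : free [:: w; t; y; z].
    by rewrite free_cons nw free_cons nt (basis_free bM).
  pose Bi (i : 'I_3) := nth B1 [:: B1; B2; B3] i.
  have [k [[i ki] ka kb]] := kernel_pair (fun i => Bi i y t) (fun i => Bi i y w).
  pose k0 := k ord0; pose k1 := k (lift ord0 ord0).
  pose k2 := k (lift ord0 (lift ord0 ord0)).
  have kE (f : 'I_3 -> F) : \sum_i k i * f i = k0 * f ord0 +
      (k1 * f (lift ord0 ord0) + k2 * f (lift ord0 (lift ord0 ord0))).
    by rewrite !big_ord_recl big_ord0 addr0.
  have alt' := alternating_comb3 k0 k1 k2 a1 a2 a3.
  have [|u] := aniso k0 k1 k2 _ y y0.
    apply: contraLR ki; rewrite !negb_or !negbK => /and3P[/eqP h0 /eqP h1 /eqP h2].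
    case: i => [[|[|[|]]]] //= hi; apply/eqP;
    [rewrite -h0 | rewrite -h1 | rewrite -h2];
    by congr (k _); apply: val_inj.
  case/negP; apply/eqP; have [c [d [f [g ->]]]] := free_span4 hV frw u.
  rewrite !(altDr alt') !(altZr alt') (altxx alt').
  have -> : comb3 k0 k1 k2 B1 B2 B3 y z = 0.
    by rewrite /comb3 z1 z2 z3 !mulr0 !addr0.
  have -> : comb3 k0 k1 k2 B1 B2 B3 y t = 0.
    by move: ka; rewrite kE /comb3 addrA.
  have -> : comb3 k0 k1 k2 B1 B2 B3 y w = 0.
    by move: kb; rewrite kE /comb3 addrA.
  by rewrite !mulr0 !addr0.
have rep M y z : basis_of M [:: y; z] -> exists2 N, par M N &
    e0 \in N /\ vec (B1 y z) (B2 y z) (B3 y z) \in N.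
  move=> bM; have [N pN Ne] := par_line hpar M e00; exists N => //; split=> //.
  have [t bN] := plane_basis_from (dim_line N) e00 Ne.
  have Nt : t \in N by apply: (basis_mem bN); rewrite !inE eqxx orbT.
  have [k [p [q [r et]]]] := free_span4 hV fr t.
  have Nv : vec p q r \in N.
    have -> : vec p q r = t - k *: e0.
      by apply/eqP; rewrite eq_sym subr_eq et [X in _ == X]addrC /vec !addrA.
    by rewrite memvB ?memvZ.
  have pqr : [|| p != 0, q != 0 | r != 0].
    have [_] := basis2_free bN; apply: contraNT; rewrite !negb_or !negbK.
    case/and3P=> /eqP p0 /eqP q0 /eqP r0.
    by rewrite et p0 q0 r0 !scale0r !addr0 memvZ ?memv_line.
  have pM := par_sym hpar pN.
  have My : y \in M by apply: (basis_mem bM); rewrite inE eqxx.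
  have Mz : z \in M by apply: (basis_mem bM); rewrite !inE eqxx orbT.
  have /= h1 := c1 N _ _ _ Ne Nv M y z pM My Mz.
  have /= h2 := c2 N _ _ _ Ne Nv M y z pM My Mz.
  have /= h3 := c3 N _ _ _ Ne Nv M y z pM My Mz.
  have E1 := subr0_eq h1; have E2 := subr0_eq h2; have E3 := subr0_eq h3.
  suff [mu [-> -> ->]] : exists mu,
      [/\ B1 y z = mu * p, B2 y z = mu * q & B3 y z = mu * r].
    by rewrite /vec -!scalerA -!scalerDr memvZ.
  case/or3P: pqr => n0.
  - exists (B1 y z / p); rewrite mulfVK //; split=> //; apply: (mulfI n0).
      by rewrite -E3; field.
    by rewrite E2; field.
  - exists (B2 y z / q); rewrite mulfVK //; split=> //; apply: (mulfI n0).
      by rewrite E3; field.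
    by rewrite -E1; field.
  - exists (B3 y z / r); rewrite mulfVK //; split=> //; apply: (mulfI n0).
      by rewrite -E2; field.
    by rewrite E1; field.
exists [tuple e0; e1; e2; e3], B1, B2, B3; split=> //.
  by rewrite basisEfree fr subvf hV.
move=> M N y z y' z' l bM bN l0 h1 h2 h3.
have [M0 pM [Me Mv]] := rep M y z bM; have [N0 pN [Ne Nv]] := rep N y' z' bN.
suff e : M0 = N0 by apply: par_trans pM _ => //; rewrite e; exact: par_sym.
have nz := nzp M y z bM.
have Nv' : vec (B1 y z) (B2 y z) (B3 y z) \in N0.
  move: Nv; rewrite h1 h2 h3 /vec -!scalerA -!scalerDr.
  by rewrite rpredZeq (negPf l0).
have fv : free [:: e0; vec (B1 y z) (B2 y z) (B3 y z)].
  apply/free2P => k m e.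
  have /free4P/(_ k (m * B1 y z) (m * B2 y z) (m * B3 y z)) := fr.
  have := e; rewrite /vec !scalerDr !scalerA !addrA => e' /(_ e')[-> lp lq lr].
  split=> //; apply/eqP; apply: contraLR nz => m0; rewrite !negb_or !negbK.
  move/eqP: lp; rewrite mulf_eq0 (negPf m0) /= => ->.
  move/eqP: lq; rewrite mulf_eq0 (negPf m0) /= => ->.
  by move/eqP: lr; rewrite mulf_eq0 (negPf m0) /= => ->.
by apply: (line_eq (basis2_dimE (dim_line M0) Me Mv fv)).
Qed.

End NetOfForms.

(** * Recovering the Clifford structure *)

Section CliffordFromNet.
Local Open Scope ring_scope.
Variables (F : fieldType) (V : vectType F).
Implicit Types (x y z u v w : V) (M N : line V).

Definition coords (e : 4.-tuple V) x : 'rV[F]_4 := \row_i coord e i x.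

Lemma coords_linear e : linear (coords e).
Proof. by move=> a x y; apply/rowP => i; rewrite !mxE linearP. Qed.

Lemma alternating_mxform (e : 4.-tuple V) B : basis_of {:V} e -> alternating B ->
  exists2 G, is_altmx G & forall x y, B x y = mxform G (coords e x) (coords e y).
Proof.
move=> be altB; pose b k := e`_k.
exists (altmx (B (b 0) (b 1)) (B (b 0) (b 2)) (B (b 0) (b 3))
              (B (b 1) (b 2)) (B (b 1) (b 3)) (B (b 2) (b 3)))%N.
  by do 6!eexists.
have dec x : x = \sum_(i < 4) coords e x 0 i *: b i.
  rewrite {1}(coord_basis be (memvf x)); apply: eq_bigr => i _.
  by rewrite mxE.
move=> x y; rewrite {1}[x]dec {1}[y]dec.
rewrite /mxform !mxE !big_ord_recl !big_ord0 !mxE !big_ord_recl !big_ord0.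
rewrite !mxE /= !addr0.
rewrite !(altDl altB) !(altZl altB) !(altDr altB) !(altZr altB) !(altxx altB).
rewrite (altN altB (b 0%N) (b 1%N)) (altN altB (b 0%N) (b 2%N)).
rewrite (altN altB (b 0%N) (b 3%N)) (altN altB (b 1%N) (b 2%N)).
rewrite (altN altB (b 1%N) (b 3%N)) (altN altB (b 2%N) (b 3%N)).
ring.
Qed.

Lemma mxform_comb3 a b c (G1 G2 G3 : 'M[F]_4) (x y : 'rV[F]_4) :
  mxform (a *: G1 + b *: G2 + c *: G3) x y =
  a * mxform G1 x y + b * mxform G2 x y + c * mxform G3 x y.
Proof.
by rewrite /mxform !mulmxDr !mulmxDl -!scalemxAr -!scalemxAl !mxE.
Qed.

Hypothesis hV : \dim {:V} = 4%N.
Variables (par : line V -> line V -> Prop) (hpar : parallelism par).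

(** Given parallel M and N, translate M so that it shares a point with N: the
    translate is parallel to M by assumption, hence equal to N. *)
Lemma left_translation_clifford (H : falgType F) (phi : 'Hom(V, H)) :
    division_algebra H -> condition_A H \/ condition_B H -> bijective phi ->
    (forall M N, left_parallel (phi @: M)%VS (phi @: N)%VS -> par M N) ->
  clifford par.
Proof.
move=> divH AB bphi lp; exists H, phi; split=> //; left=> M N.
split=> [pMN | ]; last exact: lp.
have kphi : lker phi == 0%VS by apply/lker0P; exact: bij_inj.
have phi0 x : x != 0 -> phi x != 0.
  by move=> x0; rewrite -(linear0 phi) (inj_eq (lker0P kphi)).
have pt (L : line V) : exists2 x, x != 0 & x \in L.
  have [x [y b]] := plane_basis (dim_line L); have [x0 _] := basis2_free b.
  by exists x => //; apply: (basis_mem b); rewrite inE eqxx.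
have [x x0 Mx] := pt M; have [y y0 Ny] := pt N.
pose c := phi y / phi x.
have c0 : c != 0.
  by apply: contraNneq (phi0 y y0) => e; rewrite -(mulrVK (divH _ (phi0 x x0)) (phi y))
    -/c e mul0r.
have full : limg phi = fullv.
  apply/eqP; rewrite eqEsubv subvf; apply/subvP => h _.
  by have [psi _ phiK] := bphi; rewrite -[h]phiK memv_img ?memvf.
have sub U : (U <= limg phi)%VS by rewrite full subvf.
pose N' := (phi @^-1: (amull c @: (phi @: M)))%VS.
have imN' : (phi @: N')%VS = (amull c @: (phi @: M))%VS by rewrite lpreimK.
have dphi U : \dim (phi @: U) = \dim U by rewrite limg_dim_eq // (eqP kphi) capv0.
have dN' : \dim N' == 2%N.
  by rewrite -dphi imN' (dim_amull divH _ c0) dphi dim_line.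
have pMN' : par M (Line dN') by apply: lp; exists c.
have N'y : y \in N'.
  rewrite -memv_preim; apply/memv_imgP; exists (phi x); first exact: memv_img.
  by rewrite lfunE /= /c mulrVK // divH ?phi0.
have e : Line dN' = N.
  exact: (par_meet hpar (par_trans hpar (par_sym hpar pMN') pMN) y0 N'y Ny).
by exists c => //; rewrite -e.
Qed.

Lemma net_clifford :
  (forall M1 M2, ~ par M1 M2 ->
    exists B, [/\ alternating B, exists x y, B x y != 0,
      class_isotropic par B M1 & class_isotropic par B M2]) ->
  clifford par.
Proof.
case/(parallelism_net hV hpar) => e [B1 [B2 [B3 [be [a1 a2 a3] aniso parN]]]].
have [G1 g1 E1] := alternating_mxform be a1.
have [G2 g2 E2] := alternating_mxform be a2.
have [G3 g3 E3] := alternating_mxform be a3.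
pose rL : {linear V -> 'rV[F]_4} :=
  HB.pack (coords e) (GRing.isLinear.Build _ _ _ _ (coords e) (coords_linear e)).
pose r := linfun rL.
have rE x : r x = coords e x by rewrite lfunE.
have kr : lker r == 0%VS.
  rewrite -subv0; apply/subvP => x; rewrite memv_ker memv0 rE => /eqP x0.
  apply/eqP; rewrite (coord_basis be (memvf x)) big1 // => i _.
  by have := congr1 (fun u : 'rV_4 => u 0 i) x0; rewrite !mxE => ->; rewrite scale0r.
have fr : limg r = fullv.
  apply/eqP; rewrite eqEdim subvf limg_dim_eq ?(eqP kr) ?capv0 //.
  by rewrite hV dimvf.
have [|H [psi [[kpsi fpsi] divH AB inv]]] := anisotropic_net_algebra g1 g2 g3.
  move=> a b c nz; rewrite -[_ \is a _]/(_ \in unitmx) -row_free_unit -kermx_eq0.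
  apply: contraT; rewrite -nz_row_eq0; set x := nz_row _ => x0.
  have /sub_kermxP kx : (x <= kermx (a *: G1 + b *: G2 + c *: G3))%MS.
    exact: nz_row_sub.
  have : x \in limg r by rewrite fr memvf.
  case/memv_imgP=> v _ xv.
  have v0 : v != 0 by apply: contraNneq x0 => v0; rewrite xv v0 linear0.
  have [y] := aniso a b c nz v v0; rewrite /comb3 E1 E2 E3 -!rE -xv.
  rewrite -mxform_comb3 /mxform kx mul0mx mxE eqxx //.
have psiV (u : 'rV[F]_4) : psi (psi^-1%VF u) = u.
  by apply: limg_lfunVK; rewrite fpsi memvf.
pose phi := (psi^-1 \o r)%VF.
have psiphi x : psi (phi x) = r x by rewrite comp_lfunE psiV.
have bphi : bijective phi.
  exists (r^-1 \o psi)%VF => x; rewrite !comp_lfunE.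
    by rewrite psiV lker0_lfunK.
  by rewrite limg_lfunVK ?fr ?memvf // lker0_lfunK.
apply: (left_translation_clifford divH AB bphi) => M N [c c0 eN].
have [l l0 {}inv] := inv c c0.
have [y [z bM]] := plane_basis (dim_line M).
have [phi' phi'K phiK'] := bphi.
pose y' := phi' (c * phi y); pose z' := phi' (c * phi z).
have ey : phi y' = c * phi y by rewrite phiK'.
have ez : phi z' = c * phi z by rewrite phiK'.
have kphi : injective phi by exact: can_inj phi'K.
have inN t t' : phi t' = c * phi t -> t \in M -> t' \in N.
  move=> et Mt; have : phi t' \in (phi @: N)%VS.
    rewrite -eN et; apply/memv_imgP; exists (phi t); first exact: memv_img.
    by rewrite [RHS]lfunE.
  by case/memv_imgP=> w Nw /kphi ->.
have bN : basis_of N [:: y'; z'].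
  apply: basis2_dimE; first exact: dim_line.
  - by apply: (inN y) => //; apply: (basis_mem bM); rewrite inE eqxx.
  - by apply: (inN z) => //; apply: (basis_mem bM); rewrite !inE eqxx orbT.
  have /free2P frM := basis_free bM.
  apply/free2P => a b e0; apply: frM; apply: kphi; apply: (mulrI (divH c c0)).
  rewrite linear0 mulr0 -(linear0 phi) -e0 !linearD !linearZ /= mulrDr.
  by rewrite -!scalerAr -ey -ez.
have eB G B : (forall x y, B x y = mxform G (coords e x) (coords e y)) ->
    G \in [:: G1; G2; G3] -> B y' z' = l * B y z.
  by move=> EB GG; rewrite !EB -!rE -!psiphi ey ez inv.
apply: (parN _ _ _ _ _ _ _ bM bN l0).
- by apply: eB E1 _; rewrite !inE eqxx.
- by apply: eB E2 _; rewrite !inE eqxx orbT.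
- by apply: eB E3 _; rewrite !inE eqxx !orbT.
Qed.

Lemma complexes_clifford :
  (forall C1 C2 : set (line V),
    parallel_class par C1 -> parallel_class par C2 -> C1 <> C2 ->
    exists K,
      unique (fun K' => [/\ linear_complex K', C1 `<=` K' & C2 `<=` K']) K
      /\ general_complex K) ->
  clifford par.
Proof.
move=> hc; apply: net_clifford => M1 M2 nM.
have [|||K [[[[W hW eK] s1 s2] _] _]] := hc [set N | par M1 N] [set N | par M2 N].
- by exists M1.
- by exists M2.
- move=> e; apply: nM; have : [set N | par M2 N] M2 by exact: par_refl.
  by rewrite -e.
have [B [altB nB BE]] := complex_alternating hW.
exists B; split=> //.
- by apply: (complex_total altB BE) => N p; rewrite -eK; exact: s1.
- by apply: (complex_total altB BE) => N p; rewrite -eK; exact: s2.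
Qed.

End CliffordFromNet.

Theorem theorem6p2 (F : fieldType) (V : vectType F) (hV : \dim {:V} = 4%N)
    (par : line V -> line V -> Prop) (hpar : parallelism par) :
  [<-> clifford par;
       forall C1 C2 : set (line V),
         parallel_class par C1 -> parallel_class par C2 -> C1 <> C2 ->
         exists H, geometric_hyperplane H /\ C1 `<=` H /\ C2 `<=` H;
       forall C1 C2 : set (line V),
         parallel_class par C1 -> parallel_class par C2 -> C1 <> C2 ->
         exists K,
           unique (fun K' => [/\ linear_complex K', C1 `<=` K' & C2 `<=` K']) K
           /\ general_complex K].
Proof.
tfae.
- exact: clifford_hyperplane.
- exact: hyperplane_general_complex.
- exact: complexes_clifford.
Qed.
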